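(* Let $\mathcal{P}$ be a nontrivial monotone and non-evasive graph property on $10$ vertices. Define the following graphs on $10$ vertices: $G_1=\overline{K}_5\cup C_5$, $G_2=\overline{K}_5\cup K_5$, $G_3=C_5\cup C_5$, $G_4=C_5\cup K_5$, $G_5=K_5\cup K_5$, and let $\overline{G}_i$ be the complement of $G_i$ for $i=1,\ldots,5$. Then $\mathcal{P}$ is of type $k$ for some $k\in\{2,4,5,6,8\}$; that is, the set of those isomorphism classes among the ten classes $[G_i],[\overline{G}_i]$ ($1\leq i\leq 5$) that are contained in $\mathcal{P}$ is equal to one of the following sets: $$I_2=\{[G_1],[\overline{G}_4],[\overline{G}_5]\},$$ $$I_4=\{[G_1],[G_2],[\overline{G}_2],[\overline{G}_4],[\overline{G}_5]\},$$ $$I_5=\{[G_1],[G_2],[G_3],[G_4],[G_5]\},$$ $$I_6=\{[G_1],[G_3],[\overline{G}_3],[\overline{G}_4],[\overline{G}_5]\},$$ $$I_8=\{[G_1],[G_2],[G_3],[\overline{G}_2],[\overline{G}_3],[\overline{G}_4],[\overline{G}_5]\}.$$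
   Context: Graphs are finite and simple. A graph property $\mathcal{P}$ on $n$ vertices is a collection of graphs with vertex set $\{1,\ldots,n\}$ (identified with their edge sets) that is closed under isomorphism of graphs. Its complexity $c(\mathcal{P})$ is the minimum $k$ such that some adaptive strategy of questions of the form ''is $\{i,j\}$ an edge of $G$?'' always determines, for every unknown graph $G$ on $\{1,\ldots,n\}$, whether $G\in\mathcal{P}$ using at most $k$ questions. $\mathcal{P}$ is evasive if $c(\mathcal{P})=\binom{n}{2}$, and non-evasive otherwise. $\mathcal{P}$ is monotone if it is closed under removal of edges. $\mathcal{P}$ is trivial if it is empty or consists of all graphs on $\{1,\ldots,n\}$, and nontrivial otherwise. $K_5$ is the complete graph on $5$ vertices, $\overline{K}_5$ is the graph on $5$ vertices with no edges, $C_5$ is the cycle of length $5$, and $\cup$ denotes the disjoint union of graphs. $[G]$ denotes the isomorphism class of $G$, i.e. the set of all graphs on the vertex set $\{1,\ldots,10\}$ isomorphic to $G$. For the sets $I_k$ listed in the claim, $\mathcal{P}$ is said to be of type $k$ if the classes among $[G_i],[\overline{G}_i]$ ($1\le i\le 5$) contained in $\mathcal{P}$ are exactly those in $I_k$. *)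

(* Defs.v *)
From mathcomp Require Import all_boot all_fingroup.
From mathcomp Require Import boolp.
Set Implicit Arguments.
Unset Strict Implicit.
Unset Printing Implicit Defensive.

(* Vertices are numbered 0, ..., n-1 rather than 1, ..., n. *)
Notation edge n := {e : {set 'I_n} | #|e| == 2}.

(* A simple graph is identified with its edge set, so that ~: G is the        *)
(* complement graph, set0 the empty graph and [set: edge n] the complete one. *)
Notation graph n := {set edge n}.

Definition adj n (G : graph n) : rel 'I_n :=
  fun x y => [exists e in G, val e == [set x; y]].

(* The symmetric closure of r with its diagonal removed. *)
Definition graph_of n (r : rel 'I_n) : graph n :=
  [set e : edge n | [exists x, exists y, (val e == [set x; y]) && r x y]].

Definition empty_graph n : graph n := set0.

Definition complete_graph n : graph n := [set: edge n].

Definition cycle_graph n : graph n := graph_of (fun x y : 'I_n => y == ordS x).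

Definition disjoint_union m n (G : graph m) (H : graph n) : graph (m + n) :=
  graph_of (fun x y : 'I_(m + n) =>
    match split x, split y with
    | inl a, inl b => adj G a b
    | inr a, inr b => adj H a b
    | _, _ => false
    end).

Definition isomorphic n (G H : graph n) : bool :=
  [exists s : 'S_n, [forall x, forall y, adj G x y == adj H (s x) (s y)]].

Definition iso_class n (G : graph n) : {set graph n} :=
  [set H | isomorphic G H].

Definition graph_property n (P : {set graph n}) : Prop :=
  forall G H : graph n, isomorphic G H -> G \in P -> H \in P.

Definition monotone n (P : {set graph n}) : Prop :=
  forall (G : graph n) (e : edge n), G \in P -> G :\ e \in P.

Definition trivial n (P : {set graph n}) : Prop :=
  P = set0 \/ P = [set: graph n].

(* In Query e t u, the strategy goes on with t if e is an edge of the unknown *)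
(* graph, and with u otherwise.                                               *)
Inductive strategy (n : nat) : Type :=
| Answer of bool
| Query of edge n & strategy n & strategy n.
Arguments Answer {n}.

Fixpoint run n (t : strategy n) (G : graph n) : bool :=
  match t with
  | Answer b => b
  | Query e t1 t0 => if e \in G then run t1 G else run t0 G
  end.

Fixpoint questions n (t : strategy n) : nat :=
  match t with
  | Answer _ => 0
  | Query _ t1 t0 => (maxn (questions t1) (questions t0)).+1
  end.

Definition determined_within n (P : {set graph n}) (k : nat) : Prop :=
  exists2 t : strategy n,
    questions t <= k & forall G : graph n, run t G = (G \in P).

Lemma strategy_exists n (s : seq (edge n)) (f : graph n -> bool) :
  (forall G H : graph n, {in s, forall e, (e \in G) = (e \in H)} -> f G = f H) ->
  exists2 t : strategy n, questions t <= size s & forall G, run t G = f G.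
Proof.
elim: s f => [|e s IHs] f fP.
  by exists (Answer (f set0)) => //= G; apply: fP.
have [|t1 t1_le t1P] := IHs (fun G => f (e |: G)).
  move=> G H GH; apply: fP => e'; rewrite inE !in_setU1.
  by case: eqP => //= _ /GH.
have [|t0 t0_le t0P] := IHs (fun G => f (G :\ e)).
  move=> G H GH; apply: fP => e'; rewrite inE !in_setD1.
  by case: eqP => //= _ /GH.
exists (Query e t1 t0) => [|G] /=; first by rewrite ltnS geq_max t1_le.
rewrite t1P t0P; case: ifPn => eG; first by congr f; apply/setUidPr; rewrite sub1set.
by congr f; apply/setDidPl; rewrite disjoint_sym disjoints1.
Qed.

Lemma ex_determined_within n (P : {set graph n}) :
  exists k, `[< determined_within P k >].
Proof.
have [|t _ tP] := @strategy_exists n (enum {: edge n}) (fun G => G \in P).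
  by move=> G H GH; congr (_ \in P); apply/setP => e; apply: GH; rewrite mem_enum.
by exists (questions t); apply/asboolP; exists t.
Qed.

Definition complexity n (P : {set graph n}) : nat :=
  ex_minn (ex_determined_within P).

Definition evasive n (P : {set graph n}) : Prop := complexity P = 'C(n, 2).

Definition G1 : graph 10 := disjoint_union (empty_graph 5) (cycle_graph 5).
Definition G2 : graph 10 := disjoint_union (empty_graph 5) (complete_graph 5).
Definition G3 : graph 10 := disjoint_union (cycle_graph 5) (cycle_graph 5).
Definition G4 : graph 10 := disjoint_union (cycle_graph 5) (complete_graph 5).
Definition G5 : graph 10 := disjoint_union (complete_graph 5) (complete_graph 5).

Definition ten_classes : {set {set graph 10}} :=
  [set iso_class G1; iso_class G2; iso_class G3; iso_class G4; iso_class G5;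
       iso_class (~: G1); iso_class (~: G2); iso_class (~: G3);
       iso_class (~: G4); iso_class (~: G5)].

Definition classes_in (P : {set graph 10}) : {set {set graph 10}} :=
  [set C in ten_classes | C \subset P].

Definition I2 : {set {set graph 10}} :=
  [set iso_class G1; iso_class (~: G4); iso_class (~: G5)].
Definition I4 : {set {set graph 10}} :=
  [set iso_class G1; iso_class G2;
       iso_class (~: G2); iso_class (~: G4); iso_class (~: G5)].
Definition I5 : {set {set graph 10}} :=
  [set iso_class G1; iso_class G2; iso_class G3; iso_class G4; iso_class G5].
Definition I6 : {set {set graph 10}} :=
  [set iso_class G1; iso_class G3;
       iso_class (~: G3); iso_class (~: G4); iso_class (~: G5)].
Definition I8 : {set {set graph 10}} :=
  [set iso_class G1; iso_class G2; iso_class G3;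
       iso_class (~: G2); iso_class (~: G3);
       iso_class (~: G4); iso_class (~: G5)].

(* Main.v *)
From HB Require Import structures.
Require Import Defs.
From mathcomp Require Import all_boot all_order all_algebra all_fingroup.
From mathcomp Require Import ring zify boolp.
Set Implicit Arguments.
Unset Strict Implicit.
Unset Printing Implicit Defensive.
Import GRing.Theory Num.Theory.
Local Open Scope ring_scope.

(** Nonempty graphs of P form a poset whose order complex is acyclic when P is nonevasive:
    an optimal strategy contracts it by induction on its depth, and the same holds for the
    graphs of P above the edge queried first.  By Smith theory the graphs fixed by an
    automorphism of prime order p are acyclic modulo p, hence over the rationals, and by
    Lefschetz the graphs fixed moreover by a permutation b normalising that automorphism
    have reduced Euler characteristic 0 (Oliver).  Each such group with few edge orbits
    gives a linear equation between memberships in P.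
    The groups Z_5 x Z_5 and (Z_5 x Z_5) : Z_2 acting on 5 + 5 vertices leave the five
    types, and the two cases in which K_5,5 (up to isomorphism) is the only one of the ten
    graphs in P, or K_5 + K_5 the only one not in P.  The first of these is excluded by
    Z_2 x Z_8 acting on 2 + 8 vertices, applied above an edge; the second one is dual. *)

(** * Chains of a strict order *)

(** Order complexes replace P itself because a chain of graphs preserved by an automorphism is fixed
    graph by graph, so its fixed part is again an order complex, that of the fixed graphs. The empty
    chain is kept: acyclicity is then plain exactness of one ungraded operator, homology is measured
    by dim V - 2 dim dV, and the alternating sum over all chains is minus the reduced Euler
    characteristic. Graphs fixed by a group are unions of its edge orbits. Those in P form a
    down-closed part of a Boolean lattice, whose Möbius function is a sign, so the sum over chains
    collapses to the sum of (-1)^(number of orbits) over the unions in P. The groups on 5 + 5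
    vertices are chosen because each half of a fixed graph is empty, a five-cycle (C_5 is
    self-complementary) or K_5, with all or no edges in between: up to isomorphism the ten graphs,
    the empty one and the complete one. Twelve booleans thus carry all that these groups say, and
    enumeration solves the constraints. The two exceptional vectors satisfy all of them, which is
    why another action is called for. *)

Section OrderComplex.
Variables (T : finType) (lt : rel T).
Hypotheses (lt_irr : irreflexive lt) (lt_trans : transitive lt).
Implicit Types (X c d : {set T}) (x y z : T).

Definition chain (c : {set T}) : bool :=
  [forall x in c, forall y in c, [|| x == y, lt x y | lt y x]].

Definition chains (X : {set T}) : {set {set T}} :=
  [set c : {set T} | (c \subset X) && chain c].

Definition link (X : {set T}) (x : T) : {set T} := [set y in X | lt y x || lt x y].

Lemma chainP (c : {set T}) :
  reflect {in c &, forall x y, [|| x == y, lt x y | lt y x]} (chain c).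
Proof.
apply: (iffP forall_inP) => [h x y xc yc|h x xc]; first exact: (forall_inP (h x xc)).
by apply/forall_inP => y yc; apply: h.
Qed.

Lemma chain_sub (c d : {set T}) : d \subset c -> chain c -> chain d.
Proof. by move=> /subsetP dc /chainP h; apply/chainP => x y /dc xc /dc; apply: h. Qed.

Lemma chains_sub (X c d : {set T}) : d \subset c -> c \in chains X -> d \in chains X.
Proof.
by move=> dc; rewrite !inE => /andP[cX /(chain_sub dc)->]; rewrite (subset_trans dc cX).
Qed.

Lemma lt_asym x y : lt x y -> lt y x = false.
Proof. by move=> xy; apply/negP => yx; have := lt_trans xy yx; rewrite lt_irr. Qed.

Lemma chainsU1 (X d : {set T}) (x : T) : x \in X -> x \notin d ->
  (x |: d \in chains X) = (d \in chains (link X x)).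
Proof.
move=> xX xd; apply/idP/idP.
  rewrite !inE subUset => /andP[/andP[_ dX] ch].
  rewrite (chain_sub _ ch) ?subsetUr // andbT.
  apply/subsetP => y yd; rewrite inE (subsetP dX) //=.
  have /chainP/(_ y x) := ch; rewrite !inE yd eqxx orbT => /(_ isT isT).
  by case/predU1P => // yx; rewrite -yx yd in xd.
rewrite !inE subUset sub1set xX => /andP[/subsetP dL ch] /=.
apply/andP; split; first by apply/subsetP => y /dL; rewrite inE => /andP[].
apply/chainP => y z; rewrite !inE => /predU1P[->|yd] /predU1P[->|zd].
- by rewrite eqxx.
- by have := dL z zd; rewrite inE => /andP[_ /orP[]->]; rewrite ?orbT.
- by have := dL y yd; rewrite inE => /andP[_ /orP[]->]; rewrite ?orbT.
- by have /chainP := ch; apply.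
Qed.

Lemma notin_link (X : {set T}) x : x \notin link X x.
Proof. by rewrite inE lt_irr andbF. Qed.

Section Boundary.
Variable R : comNzRingType.
Implicit Types (f g h : {set T} -> R).

(** The exponent is the position of [x] in the increasing list of [x |: d], so this is the usual
    simplicial sign without a total order on [T]. *)
Definition sgn_in (x : T) (d : {set T}) : R := (-1) ^+ #|[set y in d | lt y x]|.

(** The simplicial boundary on coefficients: the value at [d] collects the simplices having [d] as a
    facet. Its value at [set0] is the augmentation. *)
Definition bd f (d : {set T}) : R := \sum_(x | x \notin d) sgn_in x d * f (x |: d).

Definition supported (X : {set T}) f := forall c, c \notin chains X -> f c = 0.

(** Vanishing of reduced homology. The empty poset is not exact: the indicator of the empty chain is
    a cycle that bounds nothing. *)
Definition exact_poset (X : {set T}) : Prop :=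
  forall f, supported X f -> bd f =1 (fun=> 0) -> exists2 g, supported X g & bd g =1 f.

(** The join of the point [x] with a chain [h] of its link. *)
Definition join_pt x h (d : {set T}) : R :=
  if x \in d then sgn_in x (d :\ x) * h (d :\ x) else 0.

Lemma sgn_inK x d (r : R) : sgn_in x d * (sgn_in x d * r) = r.
Proof. by rewrite mulrA -expr2 sqrr_sign mul1r. Qed.

Lemma sgn_inU1 x y (d : {set T}) : y \notin d ->
  sgn_in x (y |: d) = (-1) ^+ lt y x * sgn_in x d.
Proof.
move=> yd; rewrite /sgn_in -exprD; congr (_ ^+ _).
case: (boolP (lt y x)) => yx.
  rewrite (_ : [set _ in _ | _] = y |: [set z in d | lt z x]).
    by rewrite cardsU1 !inE (negbTE yd).
  apply/setP => z; rewrite !inE; case: eqP => [->|] //=; by rewrite yx.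
rewrite add0n; apply: eq_card => z; rewrite !inE.
by case: eqP => [->|] //=; rewrite (negbTE yx) (negbTE yd).
Qed.

Lemma bd_add f g d : bd (fun c => f c + g c) d = bd f d + bd g d.
Proof. by rewrite -big_split /=; apply: eq_bigr => x _; rewrite mulrDr. Qed.

Lemma bd_opp f d : bd (fun c => - f c) d = - bd f d.
Proof. by rewrite -sumrN; apply: eq_bigr => x _; rewrite mulrN. Qed.

Lemma eq_bd f g : f =1 g -> bd f =1 bd g.
Proof. by move=> fg d; apply: eq_bigr => x _; rewrite fg. Qed.

Lemma supported_bd X f : supported X f -> supported X (bd f).
Proof.
move=> fX d dX; apply: big1 => x _; rewrite fX ?mulr0 //.
by apply: contra dX; apply: chains_sub; apply: subsetUr.
Qed.

(** Inserting [x] and [y] in the two orders gives opposite signs, since only the larger of them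
    counts the other. Incomparable pairs contribute 0 because no chain contains both. *)
Lemma bd_bd X f : supported X f -> bd (bd f) =1 (fun=> 0).
Proof.
move=> fX d; pose a x y := sgn_in x d * (sgn_in y (x |: d) * f (y |: (x |: d))).
have aP x y : x \notin d -> y \notin d -> ~~ (lt x y || lt y x) -> y != x -> a x y = 0.
  move=> xd yd nxy yx; rewrite /a fX ?mulr0 //; apply: contra nxy.
  rewrite inE => /andP[_ /chainP/(_ x y)]; rewrite !inE !eqxx !orbT => /(_ isT isT).
  by rewrite eq_sym (negbTE yx).
have aN x y : x \notin d -> y \notin d -> lt x y -> a y x = - a x y.
  move=> xd yd xy; rewrite /a !sgn_inU1 // xy (lt_asym xy) setUCA.
  by rewrite expr1 expr0; ring.
transitivity (\sum_(x | x \notin d) \sum_(y | (y \notin d) && lt x y) a x y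
    + \sum_(x | x \notin d) \sum_(y | (y \notin d) && lt y x) a x y).
  rewrite -big_split; apply: eq_bigr => x xd; rewrite /bd big_distrr /=.
  rewrite (bigID (fun y => lt x y)) /=; congr (_ + _).
    apply: eq_bigl => y; rewrite !inE; case: (y =P x) => [->|] //=.
    by rewrite lt_irr andbF.
  rewrite (bigID (fun y => lt y x)) /= [X in _ + X]big1 ?addr0.
    apply: eq_bigl => y; rewrite !inE negb_or; case: (y =P x) => [->|_] /=.
      by rewrite lt_irr andbF.
    by case: (boolP (lt y x)) => yx; rewrite ?andbF // (lt_asym yx) !andbT.
  move=> y /andP[/andP[]]; rewrite !inE negb_or => /andP[yx yd] nxy nyx.
  by apply: aP => //; rewrite negb_or nxy.
rewrite [X in _ + X](exchange_big_dep (fun y => y \notin d)) /=; last first.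
  by move=> x y _ /andP[].
rewrite -big_split big1 //= => x xd.
have -> : \sum_(i | (i \notin d) && ((x \notin d) && lt x i)) a i x
    = \sum_(y | (y \notin d) && lt x y) - a x y.
  by apply: eq_big => [y|y /and3P[yd _ xy]]; [rewrite xd|exact: aN].
by rewrite sumrN subrr.
Qed.

Lemma bd_join X x h d : x \in X -> supported (link X x) h ->
  bd (join_pt x h) d =
  if x \in d then - (sgn_in x (d :\ x) * bd h (d :\ x)) else h d.
Proof.
move=> xX hL; case: ifPn => xd.
  rewrite -mulrN /bd -sumrN [in RHS]big_distrr /=.
  rewrite [RHS](bigID (fun y => y == x)) /= [X in _ = X + _]big1 ?add0r.
    apply: eq_big => y.
      by rewrite !inE negb_and negbK; case: (y =P x) => [->|_] /=; rewrite ?xd ?andbT.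
    move=> yd; rewrite /join_pt !inE xd orbT.
    have yx : y != x by apply: contraNneq yd => ->.
    have -> : (y |: d) :\ x = y |: (d :\ x).
      by apply/setP => z; rewrite !inE; case: (z =P y) => [->|] //=; rewrite yx.
    have yd' : y \notin d :\ x by rewrite !inE (negbTE yd) andbF.
    case: (boolP (y \in link X x)) => [|yL]; last first.
      rewrite hL ?mulr0 ?oppr0 ?mulr0 //; apply: contra yL; rewrite inE subUset sub1set.
      by case/andP => /andP[].
    rewrite inE => /andP[_ xy].
    rewrite -{1}(setD1K xd) !sgn_inU1 ?setD11 //.
    have e : (-1) ^+ lt x y * (-1) ^+ lt y x = -1 :> R.
      by rewrite -signr_addb; case/orP: xy => xy; rewrite xy (lt_asym xy) expr1.
    set u := sgn_in y _; set v := sgn_in x _; set w := h _.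
    by transitivity (((-1) ^+ lt x y * (-1) ^+ lt y x) * (u * v * w)); [|rewrite e]; ring.
  move=> y /andP[_ /eqP->]; rewrite hL ?mulr0 ?oppr0 ?mulr0 //.
  by rewrite inE subUset sub1set (negbTE (notin_link X x)).
rewrite /bd (bigD1 x) //= big1 ?addr0 => [|y /andP[yd yx]].
  have xdx : (x |: d) :\ x = d.
    by apply/setP => z; rewrite !inE; case: eqP => [->|] //=; rewrite (negbTE xd).
  by rewrite /join_pt setU11 xdx sgn_inK.
by rewrite /join_pt !inE eq_sym (negbTE yx) (negbTE xd) mulr0.
Qed.

Definition no_pt x f (d : {set T}) : R := if x \in d then 0 else f d.
Definition with_pt x f (d : {set T}) : R :=
  if x \in d then 0 else sgn_in x d * f (x |: d).

Lemma split_pt x f d : f d = no_pt x f d + join_pt x (with_pt x f) d.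
Proof.
rewrite /no_pt /join_pt /with_pt setD11; case: ifPn => xd; last by rewrite addr0.
by rewrite add0r setD1K // sgn_inK.
Qed.

Lemma supported_no_pt X x f : supported X f -> supported (X :\ x) (no_pt x f).
Proof.
move=> fX d dX; rewrite /no_pt; case: ifPn => // xd; apply: fX.
apply: contra dX; rewrite !inE => /andP[dX ->]; rewrite andbT.
by rewrite subsetD1 dX.
Qed.

Lemma supported_with_pt X x f : x \in X -> supported X f ->
  supported (link X x) (with_pt x f).
Proof.
move=> xX fX d dX; rewrite /with_pt; case: ifPn => // xd.
by rewrite fX ?mulr0 // chainsU1.
Qed.

Lemma supported_join_pt X x h : x \in X -> supported (link X x) h ->
  supported X (join_pt x h).
Proof.
move=> xX hL d dX; rewrite /join_pt; case: ifPn => // xd.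
by rewrite hL ?mulr0 // -chainsU1 ?setD11 // setD1K.
Qed.

Lemma bd_no_pt x f d : x \in d -> bd (no_pt x f) d = 0.
Proof.
by move=> xd; apply: big1 => y _; rewrite /no_pt !inE xd orbT mulr0.
Qed.

(** Write [f] as [no_pt] plus the join of [x] with [with_pt], and read [bd f = 0] separately at the
    chains through [x] and at those avoiding it. *)
Lemma cycle_split X x f : x \in X -> supported X f -> bd f =1 (fun=> 0) ->
  bd (with_pt x f) =1 (fun=> 0) /\ bd (no_pt x f) =1 (fun d => - with_pt x f d).
Proof.
move=> xX fX f0.
have fE d : bd (no_pt x f) d +
    (if x \in d then - (sgn_in x (d :\ x) * bd (with_pt x f) (d :\ x))
     else with_pt x f d) = 0.
  rewrite -(bd_join d xX (supported_with_pt xX fX)) -bd_add -[RHS](f0 d).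
  by apply: eq_bd => c; rewrite -split_pt.
split=> d.
  case: (boolP (x \in d)) => xd.
    by apply: big1 => y _; rewrite /with_pt !inE xd orbT mulr0.
  have := fE (x |: d); rewrite bd_no_pt ?setU11 // add0r.
  have xdx : (x |: d) :\ x = d.
    by apply/setP => z; rewrite !inE; case: eqP => [->|] //=; rewrite (negbTE xd).
  rewrite xdx => /(congr1 (fun r => sgn_in x d * - r)).
  by rewrite opprK sgn_inK oppr0 mulr0.
have := fE d; case: ifPn => xd; first by rewrite bd_no_pt // /with_pt xd oppr0.
by move/eqP; rewrite addr_eq0 => /eqP.
Qed.

(** The order complex is a cone with apex [y]: a cycle bounds the join of [y] with its part avoiding
    [y]. *)
Lemma exact_cone X y : y \in X -> {in X, forall z, z != y -> lt z y || lt y z} ->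
  exact_poset X.
Proof.
move=> yX cmp f fX f0; have [_ nb] := cycle_split yX fX f0.
have LE : link X y = X :\ y.
  apply/setP => z; rewrite !inE andbC; case: eqP => [->|/eqP zy] /=.
    by rewrite lt_irr.
  by case: (boolP (z \in X)) => zX; rewrite ?andbF ?andbT // cmp.
have nL : supported (link X y) (no_pt y f) by rewrite LE; apply: supported_no_pt.
exists (join_pt y (no_pt y f)); first exact: supported_join_pt.
move=> d; rewrite (bd_join _ yX) // [RHS](split_pt y f d) /join_pt.
case: ifPn => yd; last by rewrite addr0.
by rewrite {2}/no_pt yd add0r nb mulrN opprK.
Qed.

(** Mayer-Vietoris for [X :\ x] glued to the cone over the link: if [h] bounds the link part of [f],
    adding the boundary of the join of [x] and [h] pushes the cycle into [X :\ x]. *)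
Lemma exact_link X x : x \in X -> exact_poset (X :\ x) -> exact_poset (link X x) ->
  exact_poset X.
Proof.
move=> xX ex eL f fX f0; have [w0 nw] := cycle_split xX fX f0.
have [h hL hE] := eL _ (supported_with_pt xX fX) w0.
pose f' d := f d + bd (join_pt x h) d.
have f'E d : f' d = no_pt x f d + (if x \in d then 0 else h d).
  rewrite /f' (bd_join _ xX) // [f d](split_pt x) -addrA; congr (_ + _).
  rewrite /join_pt; case: ifPn => xd; last by rewrite add0r.
  by rewrite hE subrr.
have hX : supported (X :\ x) (fun d => if x \in d then 0 else h d).
  move=> d dX; case: ifPn => // xd; apply: hL; apply: contra dX.
  rewrite !inE => /andP[/subsetP dL ->]; rewrite andbT; apply/subsetP => z /[dup] zd /dL.
  by rewrite !inE => /andP[->]; rewrite andbT; case: eqP => // zx; rewrite -zx zd in xd.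
have f'X : supported (X :\ x) f'.
  by move=> d dX; rewrite f'E (supported_no_pt fX) // hX // addr0.
have hxE d : (if x \in d then 0 else h d) = h d.
  case: ifP => // xd; rewrite hL //; apply/negP; rewrite inE => /andP[/subsetP/(_ x xd)].
  by rewrite (negbTE (notin_link X x)).
have f'0 : bd f' =1 (fun=> 0).
  move=> d; rewrite (eq_bd (g := fun d => no_pt x f d + h d)); last first.
    by move=> c; rewrite f'E hxE.
  by rewrite bd_add nw hE addNr.
have [k kX kE] := ex _ f'X f'0.
exists (fun d => k d + - join_pt x h d) => [d dX|d].
  rewrite (supported_join_pt xX hL) // oppr0 addr0 kX //.
  apply: contra dX; rewrite !inE => /andP[dX ->]; rewrite andbT.
  exact: subset_trans dX (subD1set _ _).
by rewrite bd_add bd_opp kE /f' addrK.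
Qed.

End Boundary.
End OrderComplex.

(** * Nonevasive intervals of graphs *)

Definition psub (E : finType) : rel {set E} := fun G H => G \proper H.
Arguments psub E : clear implicits.

Lemma psub_irr (E : finType) : irreflexive (psub E).
Proof. by move=> G; rewrite /psub properxx. Qed.

Lemma psub_trans (E : finType) : transitive (psub E).
Proof. by move=> y x z; apply: proper_trans. Qed.

Section FaceInterval.
Variables (R : comNzRingType) (E : finType) (P : {set {set E}}).
Hypothesis P_down : forall G H : {set E}, G \subset H -> H \in P -> G \in P.
Implicit Types (A D G H : {set E}) (e : E).

(** The nonempty faces of the link of [A] in P, restricted to the vertex set [D]; [A] itself stands
    for the empty face. *)
Definition faces_above A D : {set {set E}} :=
  [set H in P | (A \proper H) && (H \subset A :|: D)].

Notation exact X := (exact_poset (psub E) R X).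
Let irr := @psub_irr E.
Let trn := @psub_trans E.

Lemma exact_all_faces A D e : e \in D -> [disjoint A & D] ->
  A :|: D \in P -> exact (faces_above A D).
Proof.
move=> eD AD PAD; apply: (exact_cone irr trn (y := A :|: D)).
  rewrite inE PAD subxx andbT properE subsetUl /=; apply/subsetPn; exists e.
    by rewrite inE eD orbT.
  by apply/negP => eA; move/disjoint_setI0/setP/(_ e): AD; rewrite !inE eA eD.
by move=> H; rewrite inE => /and3P[_ _ HAD] nH; rewrite /psub properEneq nH HAD.
Qed.

(** The faces in [Z] are removed smallest first. What remains below such an [H] avoids [e], hence
    lies in [H :\ e], and what lies above [H] contains it, so the link of [H] is a cone with apex
    [H :\ e]. The face [e |: A] must stay out of [Z]: its apex would be [A], which is absent. *)
Lemma exact_faces_with A D e (Z : {set {set E}}) :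
  e \in D -> e \notin A ->
  exact (faces_above A (D :\ e)) ->
  Z \subset faces_above (e |: A) (D :\ e) ->
  {in Z, forall H G, H \subset G -> G \in faces_above (e |: A) (D :\ e) -> G \in Z} ->
  exact (faces_above A (D :\ e) :|: Z).
Proof.
move=> eD eA exY; have [n] := ubnP #|Z|; elim: n Z => // n IHn Z.
rewrite ltnS => Zn /subsetP ZW Zup.
have [->|[H0 H0Z]] := set_0Vmem Z; first by rewrite setU0.
pose H := [arg min_(G < H0 in Z) #|G|]%N.
have [HZ Hmin] : H \in Z /\ forall G, G \in Z -> (#|H| <= #|G|)%N.
  by rewrite /H; case: arg_minnP.
have := ZW H HZ; rewrite inE => /and3P[HP AH HD].
have eH : e \in H by apply: (subsetP (proper_sub AH)); rewrite setU11.
have HY G : G \in faces_above A (D :\ e) -> e \notin G.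
  rewrite inE => /and3P[_ _ /subsetP GD]; apply/negP => /GD.
  by rewrite !inE eqxx (negbTE eA).
have HHY : H \notin faces_above A (D :\ e) by apply/negP => /HY; rewrite eH.
have yY : H :\ e \in faces_above A (D :\ e).
  rewrite inE (P_down (subD1set _ _) HP) /=; apply/andP; split.
    rewrite properE subsetD1 eA andbT (subset_trans _ (proper_sub AH)) ?subsetUr //=.
    move: AH; rewrite properE => /andP[_]; apply: contra => /subsetP HA.
    apply/subsetP => x xH; rewrite !inE; case: eqP => //= /eqP xe; apply: HA.
    by rewrite !inE xe.
  apply/subsetP => x; rewrite !inE => /andP[xe /(subsetP HD)].
  by rewrite !inE (negbTE xe).
apply: (exact_link irr trn (x := H)); first by rewrite inE HZ orbT.
  have -> : (faces_above A (D :\ e) :|: Z) :\ H = faces_above A (D :\ e) :|: (Z :\ H).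
    apply/setP => G; rewrite !inE; case: (G =P H) => //= ->.
    by move: HHY; rewrite inE => /negbTE->.
  apply: IHn.
  - by move: Zn; rewrite (cardsD1 H) HZ.
  - by apply/subsetP => G; rewrite inE => /andP[_ /ZW].
  - move=> G; rewrite in_setD1 => /andP[GH GZ] G' GG' G'W.
    rewrite in_setD1 (Zup G) // andbT.
    apply: contraNneq GH => G'H; rewrite G'H in GG'.
    by rewrite eqEcard GG' Hmin.
apply: (exact_cone irr trn (y := H :\ e)).
  by rewrite inE inE yY /= /psub properD1.
move=> G; rewrite inE => /andP[GX]; rewrite /psub => /orP[GH|HG] GHe.
  have GZ : G \notin Z.
    by apply/negP => /Hmin; rewrite leqNgt proper_card.
  move: GX; rewrite inE (negbTE GZ) orbF => /HY eG.
  by rewrite properEneq GHe subsetD1 eG proper_sub.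
by rewrite (proper_trans (properD1 eH) HG) orbT.
Qed.

(** Given the previous lemma, only [e |: A] has to be attached. Nothing lies strictly between [A]
    and it, so its link consists of the faces properly above it, which are exact by the second
    hypothesis. *)
Lemma exact_faces_step A D e : e \in D -> e \notin A ->
  exact (faces_above A (D :\ e)) ->
  (e |: A \in P -> exact (faces_above (e |: A) (D :\ e))) ->
  exact (faces_above A D).
Proof.
move=> eD eA ex0 ex1.
have UE : A :|: D = (e |: A) :|: (D :\ e).
  by apply/setP => x; rewrite !inE; case: eqP => [->|] //=; rewrite eD orbT.
case: (boolP (e |: A \in P)) => eAP; last first.
  suff -> : faces_above A D = faces_above A (D :\ e) by [].
  apply/setP => H; rewrite !inE; case: (boolP (H \in P)) => //= HP.
  case: (boolP (A \proper H)) => //= AH.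
  have eH : e \notin H.
    apply: contra eAP => eH; apply: P_down HP.
    by rewrite subUset sub1set eH proper_sub.
  apply/subsetP/subsetP => h x xH; have := h x xH; rewrite !inE.
    by case: (x =P e) => [xe|] //; rewrite -xe xH in eH.
  by case/orP => [->|/andP[_ ->]]; rewrite ?orbT.
have {ex1}exW := ex1 eAP.
have exYW : exact (faces_above A (D :\ e) :|: faces_above (e |: A) (D :\ e)).
  by apply: exact_faces_with.
have eAY : e |: A \notin faces_above A (D :\ e) :|: faces_above (e |: A) (D :\ e).
  rewrite !inE eAP properxx orbF /= negb_and; apply/orP; right.
  by apply/subsetPn; exists e; rewrite !inE eqxx // (negbTE eA).
have XE : faces_above A D :\ (e |: A) =
    faces_above A (D :\ e) :|: faces_above (e |: A) (D :\ e).
  apply/setP => H; rewrite !inE; case: (boolP (H \in P)) => //= HP; last by rewrite andbF.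
  rewrite -UE; case: (boolP (e \in H)) => eH.
    have -> : (H \subset A :|: D :\ e) = false.
      by apply/negP => /subsetP/(_ e eH); rewrite !inE eqxx (negbTE eA).
    rewrite andbF /= andbA; congr (_ && _).
    rewrite [e |: A \proper H]properEneq eq_sym subUset sub1set eH /=.
    case: (_ =P H) => //= AH; rewrite properE; case: (boolP (A \subset H)) => //= AH'.
    by apply/subsetPn; exists e.
  have -> : ((e |: A) \proper H) = false.
    by apply/negP => /proper_sub; rewrite subUset sub1set (negbTE eH).
  rewrite orbF; case: eqP => [HE|_] /=; first by rewrite HE setU11 in eH.
  congr (_ && _); apply/subsetP/subsetP => h x xH; have := h x xH; rewrite !inE.
    by case: (x =P e) => [xe|] //; rewrite -xe xH in eH.
  by case/orP => [->|/andP[_ ->]]; rewrite ?orbT.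
apply: (exact_link irr trn (x := e |: A)).
- rewrite inE eAP /= properE subsetUr subUset sub1set (negbTE eA) /=.
  by rewrite subUset sub1set inE eD orbT subsetUl.
- by rewrite XE.
suff -> : link (psub E) (faces_above A D) (e |: A) = faces_above (e |: A) (D :\ e) by [].
apply/setP => H; rewrite !inE -UE /psub; case: (boolP (H \in P)) => //= HP.
case: (boolP (e |: A \proper H)) => AH; rewrite ?orbT ?orbF ?andbT ?andbF //=.
  by rewrite (sub_proper_trans (subsetUr _ _) AH).
apply/negP => /andP[/andP[AH' _] HA]; move: (AH'); rewrite properE => /andP[_ /subsetPn[x xH xA]].
have := subsetP (proper_sub HA) x xH; rewrite !inE (negbTE xA) orbF => /eqP xe.
move: HA; rewrite properE => /andP[_]; rewrite subUset sub1set -xe xH /=.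
by rewrite proper_sub.
Qed.

End FaceInterval.

(** [A] holds edges known to be present and [D] the undecided ones. Since fewer than [#|D|]
    questions remain, some edge is undecided at every leaf; the answer there is yes because [A] is
    in P, so [A :|: D] is in P and is the apex of a cone. *)
Lemma exact_nonevasive (R : comNzRingType) n (P : {set graph n})
    (P_down : forall G H : graph n, G \subset H -> H \in P -> G \in P)
    (t : strategy n) (A D : graph n) :
  [disjoint A & D] -> A \in P -> (questions t < #|D|)%N ->
  (forall H : graph n, A \subset H -> H \subset A :|: D -> run t H = (H \in P)) ->
  exact_poset (psub _) R (faces_above P A D).
Proof.
elim: t A D => [b|e t1 IH1 t0 IH0] A D AD PA /= tD tP.
  have [e eD] : exists e, e \in D by apply/set0Pn; rewrite -card_gt0.
  apply: (@exact_all_faces R _ P A D e eD AD).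
  by rewrite -(tP _ (subsetUl _ _) (subxx _)) (tP A) ?subsetUl.
have [t1D t0D] : (questions t1 < #|D|.-1 /\ questions t0 < #|D|.-1)%N.
  by case: #|D| tD => // m; rewrite ltnS gtn_max => /andP[].
(* The answer to a question outside [D] is already settled by [A], so one branch is followed with
   [D] unchanged. *)
case: (boolP (e \in D)) => eD; last first.
  case: (boolP (e \in A)) => eA.
    apply: IH1 => //; first by rewrite (leq_trans t1D) ?leq_pred.
    by move=> H AH HD; rewrite -tP // (subsetP AH).
  apply: IH0 => //; first by rewrite (leq_trans t0D) ?leq_pred.
  move=> H AH HD; rewrite -tP //; case: ifP => // /(subsetP HD).
  by rewrite inE (negbTE eA) (negbTE eD).
have eA : e \notin A.
  by apply/negP => eA; move/disjoint_setI0/setP/(_ e): AD; rewrite !inE eA eD.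
have Dc : #|D :\ e| = #|D|.-1 by rewrite [in RHS](cardsD1 e D) eD.
have disj (A' : graph n) : A' \subset e |: A -> [disjoint A' & D :\ e].
  move=> /subsetP A'A; apply/pred0P => x; rewrite !inE; apply/negP => /and3P[/A'A].
  rewrite !inE => /predU1P[->|xA]; first by rewrite eqxx.
  by move=> _ xD; move/disjoint_setI0/setP/(_ x): AD; rewrite !inE xA xD.
apply: (exact_faces_step P_down eD eA).
  apply: IH0; rewrite ?Dc ?disj ?subsetUr // => H AH HD.
  rewrite -tP // ?(subset_trans HD) ?setUS ?subD1set //; case: ifP => // /(subsetP HD).
  by rewrite !inE eqxx (negbTE eA).
move=> eAP; apply: IH1; rewrite ?Dc ?disj // => H AH HD.
rewrite -tP ?(subset_trans (subsetUr _ _) AH) //.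
  by rewrite (subsetP AH) ?setU11.
apply/(subset_trans HD)/subsetP => x; rewrite !inE => /orP[/predU1P[->|->]|/andP[_ ->]] //.
  by rewrite eD orbT.
by rewrite orbT.
Qed.

(** * Smith theory *)

(** Rearranged, the kernel K of [f] on [C] and the image f C have the same total homology dimension
    dim V - 2 dim dV, as the long exact sequence of 0 -> K -> C -> f C -> 0 predicts for acyclic
    [C]. *)
Lemma dim_kernel_image (F : fieldType) (V : vectType F) (d f : 'End(V)) (C : {vspace V}) :
  (forall v, f (d v) = d (f v)) -> (C :&: lker d)%VS = (d @: C)%VS ->
  (\dim (C :&: lker f) + 2 * \dim (d @: (f @: C)) =
   \dim (f @: C) + 2 * \dim (d @: (C :&: lker f)))%N.
Proof.
move=> fd exC; have e1 := limg_ker_dim f C; have e2 := limg_ker_dim d C.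
have e3 := limg_ker_dim f (d @: C); have e4 := limg_ker_dim d (C :&: lker f).
have fdC : (f @: (d @: C) = d @: (f @: C))%VS.
  rewrite -!limg_comp; congr (_ @: _)%VS; apply/lfunP => v.
  by rewrite !comp_lfunE.
have kdC : (d @: C :&: lker f = C :&: lker f :&: lker d)%VS.
  by rewrite -exC -!capvA [(lker d :&: _)%VS]capvC.
by rewrite fdC kdC in e3; rewrite exC in e2; lia.
Qed.

(** With h the total homology dimension, the previous lemma gives h(Y) + h(sg C) = h(ta C) from [ta]
    and h(Y) + h(ta C) = h(sg C) from [sg]; hence h(Y) = 0. In the application [ta] is 1 - g, [sg]
    is the norm 1 + g + ... + g^(p-1), and [Y] is carried by the fixed chains. *)
Lemma exact_fixed_subspace (F : fieldType) (V : vectType F) (d ta sg : 'End(V))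
    (C Y : {vspace V}) :
  (forall v, ta (d v) = d (ta v)) -> (forall v, sg (d v) = d (sg v)) ->
  (C :&: lker d = d @: C)%VS ->
  (d @: Y <= Y)%VS -> (Y <= C)%VS -> (Y <= lker sg)%VS ->
  (ta @: C <= C)%VS -> (ta @: C <= lker sg)%VS ->
  (C :&: lker ta = Y + sg @: C)%VS ->
  (Y :&: sg @: C = 0)%VS -> (Y :&: ta @: C = 0)%VS ->
  (Y :&: lker d <= d @: Y)%VS.
Proof.
move=> tad sgd exC dY YC Ysg taC tasg kta Ysg0 Yta0.
have dC : (d @: C <= C)%VS by rewrite -exC capvSl.
have dim_split (f : 'End(V)) : (forall v, f (d v) = d (f v)) ->
    (Y :&: f @: C = 0)%VS ->
    (\dim (d @: (Y + f @: C)) = \dim (d @: Y) + \dim (d @: (f @: C)))%N.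
  move=> fd Yf; rewrite limgD dimv_disjoint_sum //; apply/eqP; rewrite -subv0 -Yf.
  rewrite subv_cap (subv_trans (capvSl _ _) dY) (subv_trans (capvSr _ _)) //.
  have -> : (d @: (f @: C) = f @: (d @: C))%VS.
    by rewrite -!limg_comp; congr (_ @: _)%VS; apply/lfunP => v; rewrite !comp_lfunE.
  exact: limgS.
have e1 := dim_kernel_image tad exC; have e2 := dim_kernel_image sgd exC.
(* One inclusion is given; rank-nullity for [sg] and for [ta], whose kernel is known, forces equal
   dimensions. *)
have ksg : (C :&: lker sg = Y + ta @: C)%VS.
  apply/eqP; rewrite eq_sym eqEdim subv_add !subv_cap YC Ysg taC tasg /=.
  rewrite dimv_disjoint_sum //.
  have f1 := limg_ker_dim sg C; have f2 := limg_ker_dim ta C.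
  by rewrite kta dimv_disjoint_sum // in f2; lia.
rewrite kta dim_split // dimv_disjoint_sum // in e1.
rewrite ksg dim_split // dimv_disjoint_sum // in e2.
have e3 := limg_ker_dim d Y.
have dYk : (d @: Y <= Y :&: lker d)%VS.
  rewrite subv_cap dY (subv_trans (limgS _ YC)) // -exC; exact: capvSr.
suff -> : (Y :&: lker d = d @: Y)%VS by [].
by apply/eqP; rewrite eq_sym eqEdim dYk /=; lia.
Qed.

(** * Orbits of prime order *)

Section IterOrder.
Variables (J : finType) (gm : J -> J) (p : nat).
Hypotheses (gm_inj : injective gm) (p_prime : prime p).

Lemma iter_period m c : iter m gm c = c -> forall k, iter (k * m) gm c = c.
Proof. by move=> cm; elim=> // k IHk; rewrite mulSn iterD IHk. Qed.

Lemma fixed_of_coprime m c : coprime m p -> (0 < m)%N ->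
  iter m gm c = c -> iter p gm c = c -> gm c = c.
Proof.
move=> mp m0 cm cp; case: (egcdnP p m0) => km kn e _.
have := iter_period cm km; rewrite e (eqP mp) addn1 iterS.
by rewrite (iter_period cp).
Qed.

Lemma iter_modn m c : iter p gm c = c -> iter m gm c = iter (m %% p) gm c.
Proof.
by move=> cp; rewrite {1}(divn_eq m p) addnC iterD (iter_period cp).
Qed.

(** A nontrivial orbit of prime order is free. This provides the single representative per orbit
    with which an invariant function is written as a norm. *)
Lemma root_once c : iter p gm c = c -> gm c != c ->
  exists2 i : 'I_p, iter i gm c = froot gm c &
    forall j : 'I_p, iter j gm c = froot gm c -> j = i.
Proof.
move=> cp ncg; have p0 := prime_gt0 p_prime.
have /iter_findex rE := connect_root (frel gm) c.
pose i : 'I_p := Ordinal (ltn_pmod (findex gm c (froot gm c)) p0).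
have iE : iter i gm c = froot gm c by rewrite -iter_modn.
exists i => // j; rewrite -iE => ji; apply/val_inj/eqP; apply: contraNT ncg => nij.
have inj_iter k : injective (iter k gm).
  by elim: k => // k IHk x y /= /gm_inj/IHk.
have diff (a b : 'I_p) : (a < b)%N -> iter a gm c = iter b gm c -> gm c == c.
  move=> ab; rewrite -(subnKC (ltnW ab)) iterD => /inj_iter e.
  apply/eqP/(@fixed_of_coprime (b - a)); rewrite ?subn_gt0 //.
  rewrite coprime_sym prime_coprime // gtnNdvd ?subn_gt0 //.
  exact: leq_ltn_trans (leq_subr _ _) (ltn_ord b).
by case: (ltngtP j i) nij => // h _; [apply: (diff _ _ h)|apply: (diff _ _ h)].
Qed.

End IterOrder.

Definition lin_of (I : finType) (F : fieldType) (L : {ffun I -> F^o} -> {ffun I -> F^o})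
    (L_linear : linear L) : 'End({ffun I -> F^o}) :=
  let L_mixin := GRing.isLinear.Build _ _ _ _ L L_linear in
  let LL : {linear {ffun I -> F^o} -> {ffun I -> F^o}} := HB.pack L L_mixin in
  linfun LL.

Lemma lin_ofE (I : finType) (F : fieldType) (L : {ffun I -> F^o} -> {ffun I -> F^o})
    (L_linear : linear L) v : lin_of L_linear v = L v.
Proof. by rewrite lfunE. Qed.

Section Smith.
Variables (T : finType) (lt : rel T).
Hypotheses (lt_irr : irreflexive lt) (lt_trans : transitive lt).
Variables (g : T -> T).
Hypotheses (g_inj : injective g) (g_lt : forall x y, lt (g x) (g y) = lt x y).
Implicit Types (X c d : {set T}) (x y : T).

Definition fixed X : {set T} := [set x in X | g x == x].

Lemma chain_imset c : chain lt (g @: c) = chain lt c.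
Proof.
apply/chainP/chainP => h x y.
  move=> xc yc; have := h (g x) (g y); rewrite !imset_f // (inj_eq g_inj) !g_lt.
  exact.
by case/imsetP=> x' xc -> /imsetP[y' yc ->]; rewrite (inj_eq g_inj) !g_lt; apply: h.
Qed.

Lemma chains_imset X c : {in X, forall x, g x \in X} ->
  c \in chains lt X -> g @: c \in chains lt X.
Proof.
move=> gX; rewrite !inE chain_imset => /andP[/subsetP cX ->]; rewrite andbT.
by apply/subsetP => _ /imsetP[x /cX xX ->]; apply: gX.
Qed.

Lemma iter_imset k c : iter k (fun d : {set T} => g @: d) c = [set iter k g x | x in c].
Proof.
elim: k => [|k IHk] /=; first by rewrite imset_id.
by rewrite IHk -imset_comp.
Qed.

(** [x] and [g x] both lie in the chain. If [x] were below [g x], applying [g] repeatedly would give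
    an ascending sequence that returns to [x]; likewise downwards. *)
Lemma stable_chain_pointwise c x : chain lt c -> g @: c = c -> x \in c -> g x = x.
Proof.
move=> ch gc xc; have [n xn] : exists n, iter n.+1 g x = x.
  by exists (fingraph.order g x).-1; rewrite prednK ?fingraph.order_gt0 // iter_order.
have gxc : g x \in c by rewrite -gc imset_f.
have mono k y z : lt (iter k g y) (iter k g z) = lt y z.
  by elim: k => //= k; rewrite g_lt.
have lt_iter k y : lt y (g y) -> lt y (iter k.+1 g y).
  move=> yg; elim: k => // k IHk; apply: lt_trans IHk _.
  by rewrite [iter k.+2 g y]iterSr mono.
have gt_iter k y : lt (g y) y -> lt (iter k.+1 g y) y.
  move=> yg; elim: k => // k IHk; apply: lt_trans IHk.
  by rewrite [iter k.+2 g y]iterSr mono.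
have /chainP/(_ x (g x) xc gxc)/or3P[/eqP<- //|xg|gx] := ch.
  by have := lt_iter n _ xg; rewrite xn lt_irr.
by have := gt_iter n _ gx; rewrite xn lt_irr.
Qed.

Lemma chains_fixed X c : c \in chains lt X ->
  (c \in chains lt (fixed X)) = (g @: c == c).
Proof.
rewrite !inE => /andP[/subsetP cX ch]; rewrite ch andbT; apply/subsetP/eqP => [h|gc x xc].
  rewrite -[RHS]imset_id; apply: eq_in_imset => x /h.
  by rewrite inE => /andP[_ /eqP].
by rewrite inE cX //= (stable_chain_pointwise ch gc xc).
Qed.

Lemma fixed_sub X : fixed X \subset X.
Proof. by apply/subsetP => x; rewrite inE => /andP[]. Qed.

Lemma chains_mono X (Y : {set T}) c : X \subset Y -> c \in chains lt X -> c \in chains lt Y.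
Proof. by move=> XY; rewrite !inE => /andP[cX ->]; rewrite (subset_trans cX XY). Qed.

Lemma sgn_in_imset (R : comNzRingType) x c : sgn_in lt R (g x) (g @: c) = sgn_in lt R x c.
Proof.
rewrite /sgn_in; congr (_ ^+ _).
rewrite -(card_imset (mem [set y in c | lt y x]) g_inj); apply: eq_card => y.
rewrite !inE; apply/andP/imsetP => [[/imsetP[z zc ->]]|[z]].
  by rewrite g_lt => zx; exists z => //; rewrite inE zc.
by rewrite inE => /andP[zc zx] ->; rewrite g_lt imset_f.
Qed.

Lemma bd_imset (R : comNzRingType) (f : {set T} -> R) c :
  bd lt (fun d => f (g @: d)) c = bd lt f (g @: c).
Proof.
have [h hK gK] := injF_bij g_inj.
rewrite /bd [RHS](reindex g) /=; last by exists h => ? _.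
apply: eq_big => x; first by rewrite mem_imset.
by move=> xc; rewrite sgn_in_imset imsetU1.
Qed.

Variable p : nat.
Hypothesis p_prime : prime p.
Variable F : fieldType.
Hypothesis pF : p \in [pchar F].
Variable X : {set T}.
Hypothesis gX : {in X, forall x, g x \in X}.
Hypothesis gp : {in X, forall x, iter p g x = x}.

Local Notation V := {ffun {set T} -> F^o}.
Local Notation gm := (fun d : {set T} => g @: d).

Let bdV (f : V) : V := [ffun c => bd lt f c].
Let taV (f : V) : V := [ffun c => f c - f (gm c)].
Let sgV (f : V) : V := [ffun c => \sum_(i < p) f (iter i gm c)].
(** Introduced for its kernel [supp Y], the subspace of functions supported on the chains of [Y]. *)
Let offV (Y : {set T}) (f : V) : V := [ffun c => if c \in chains lt Y then 0 else f c].

Let bdV_lin : linear bdV.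
Proof.
move=> a u v; apply/ffunP => c; rewrite !ffunE /bd scaler_sumr -big_split /=.
by apply: eq_bigr => x _; rewrite !ffunE mulrDr /GRing.scale /= mulrCA.
Qed.

Let taV_lin : linear taV.
Proof.
move=> a u v; apply/ffunP => c; rewrite !ffunE scalerBr opprD.
by rewrite addrACA.
Qed.

Let sgV_lin : linear sgV.
Proof.
move=> a u v; apply/ffunP => c; rewrite !ffunE scaler_sumr -big_split /=.
by apply: eq_bigr => i _; rewrite !ffunE.
Qed.

Let offV_lin Y : linear (offV Y).
Proof.
move=> a u v; apply/ffunP => c; rewrite !ffunE.
by case: ifP; rewrite ?scaler0 ?addr0.
Qed.

Let d := lin_of bdV_lin.
Let ta := lin_of taV_lin.
Let sg := lin_of sgV_lin.
Let supp Y := lker (lin_of (offV_lin Y)).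

Let suppP Y (v : V) : reflect (supported lt Y v) (v \in supp Y).
Proof.
rewrite memv_ker lin_ofE; apply: (iffP eqP) => [/ffunP h c cY|h].
  by have := h c; rewrite !ffunE (negbTE cY).
by apply/ffunP => c; rewrite !ffunE; case: ifPn => // /h.
Qed.

Let gm_inj : injective gm.
Proof. exact: imset_inj. Qed.

Let gm_p c : c \in chains lt X -> iter p gm c = c.
Proof.
rewrite inE => /andP[/subsetP cX _]; rewrite iter_imset -[RHS]imset_id.
by apply: eq_in_imset => x /cX; apply: gp.
Qed.

Let gm_chains c : (gm c \in chains lt X) = (c \in chains lt X).
Proof.
apply/idP/idP; last exact: chains_imset.
move=> gcX; have [n cn] : exists n, iter n.+1 gm c = c.
  exists (fingraph.order gm c).-1; rewrite prednK ?fingraph.order_gt0 //; exact: (iter_order gm_inj).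
rewrite -cn iterSr; elim: n {cn} => //= n; exact: chains_imset.
Qed.

Let iter_chains k c : (iter k gm c \in chains lt X) = (c \in chains lt X).
Proof. by elim: k => //= k IHk; rewrite gm_chains. Qed.

Let Y := fixed X.

Let fixed_iter k c : gm c = c -> iter k gm c = c.
Proof. by move=> gc; elim: k => //= k ->. Qed.

Theorem smith : exact_poset lt F X -> exact_poset lt F Y.
Proof.
move=> exX.
have bdE (f : V) c : d f c = bd lt f c by rewrite lin_ofE ffunE.
have taE (f : V) c : ta f c = f c - f (gm c) by rewrite lin_ofE ffunE.
have sgE (f : V) c : sg f c = \sum_(i < p) f (iter i gm c) by rewrite lin_ofE ffunE.
have YX : Y \subset X := fixed_sub X.
have supp_sub : (supp Y <= supp X)%VS.
  apply/subvP => v /suppP vY; apply/suppP => c cX; apply: vY.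
  by apply: contra cX; apply: chains_mono.
have d_supp Z : (d @: supp Z <= supp Z)%VS.
  apply/subvP => _ /memv_imgP[v /suppP vZ ->]; apply/suppP => c cZ.
  by rewrite bdE (supported_bd vZ).
have bd_iter (f : V) k c : bd lt f (iter k gm c) = bd lt (fun e => f (iter k gm e)) c.
  elim: k c => // k IHk c; rewrite iterSr IHk -bd_imset; apply: eq_bd => e.
  by rewrite iterSr.
have tad v : ta (d v) = d (ta v).
  apply/ffunP => c; rewrite taE !bdE -bd_imset -bd_opp -bd_add.
  by apply: eq_bd => e; rewrite taE.
have sgd v : sg (d v) = d (sg v).
  apply/ffunP => c; rewrite sgE bdE /bd.
  under [RHS]eq_bigr do rewrite sgE big_distrr.
  rewrite exchange_big /=; apply: eq_bigr => i _; rewrite bdE bd_iter.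
  by apply: eq_bigr.
have exC : (supp X :&: lker d = d @: supp X)%VS.
  apply/eqP; rewrite eqEsubv; apply/andP; split; apply/subvP => v.
    rewrite memv_cap memv_ker => /andP[/suppP vX /eqP dv].
    have [|u uX uE] := exX v vX.
      by move=> c; rewrite -bdE dv ffunE.
    have -> : v = d [ffun c => u c].
      apply/ffunP => c; rewrite bdE -uE; apply: eq_bd => e; by rewrite ffunE.
    by apply/memv_img/suppP => c /uX; rewrite ffunE.
  move=> vd; rewrite memv_cap (subvP (d_supp X)) //=; rewrite memv_ker.
  case/memv_imgP: vd => u /suppP uX ->; apply/eqP/ffunP => c.
  rewrite bdE ffunE -[RHS](bd_bd lt_irr lt_trans uX c); apply: eq_bd => e.
  by rewrite bdE.
have fixE c (v : V) : v \in supp Y -> v c != 0 -> c \in chains lt X /\ gm c = c.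
  move=> /suppP vY vc; have cY : c \in chains lt Y.
    by apply: contraNT vc => /vY->.
  by have cX := chains_mono YX cY; split=> //; apply/eqP; rewrite -(chains_fixed cX).
(* On a fixed chain the norm is [p] times the value, which vanishes in characteristic [p]. *)
have Ysg : (supp Y <= lker sg)%VS.
  apply/subvP => v vY; rewrite memv_ker; apply/eqP/ffunP => c; rewrite sgE ffunE.
  have [cY|cY] := boolP [exists i : 'I_p, v (iter i gm c) != 0].
    case/existsP: cY => i /(fixE _ _ vY)[_ ci].
    have gc : gm c = c.
      have inj_iter k : injective (iter k gm) by elim: k => // k IHk x y /= /gm_inj/IHk.
      by apply: (inj_iter i); exact: (etrans (esym (iterSr i gm c)) ci).
    under eq_bigr do rewrite fixed_iter //.
    by rewrite sumr_const card_ord -mulr_natr (pcharf0 pF) mulr0.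
  apply: big1 => i _; apply/eqP; apply: contraR cY => h; apply/existsP; by exists i.
have taC : (ta @: supp X <= supp X)%VS.
  apply/subvP => _ /memv_imgP[v /suppP vX ->]; apply/suppP => c cX.
  by rewrite taE !vX ?gm_chains // subr0.
have tasg : (ta @: supp X <= lker sg)%VS.
  apply/subvP => _ /memv_imgP[v /suppP vX ->]; rewrite memv_ker; apply/eqP/ffunP => c.
  rewrite sgE ffunE; have [cX|cX] := boolP (c \in chains lt X); last first.
    by apply: big1 => i _; rewrite taE !vX ?subr0 // ?gm_chains iter_chains.
  under eq_bigr do rewrite taE.
  rewrite -(big_mkord xpredT (fun i => v (iter i gm c) - v (iter i.+1 gm c))).
  rewrite (@telescope_sumr_eq _ 0 p (fun i => - v (iter i gm c))) //.
    by rewrite (gm_p cX) subrr.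
  by move=> k _; rewrite opprK addrC.
have sg_supp v : v \in supp X -> sg v \in supp X.
  move=> /suppP vX; apply/suppP => c cX; rewrite sgE big1 // => i _.
  by rewrite vX ?iter_chains.
have sg_inv v c : v \in supp X -> sg v (gm c) = sg v c.
  move=> /suppP vX; rewrite !sgE; have [cX|cX] := boolP (c \in chains lt X); last first.
    by rewrite !big1 // => i _; rewrite vX ?iter_chains ?gm_chains ?iter_chains.
  under eq_bigr do rewrite -iterSr.
  have := prime_gt0 p_prime; case: (p) gm_p => // q gmq _.
  rewrite big_ord_recr [RHS]big_ord_recl addrC; congr (_ + _).
  by congr (v _); apply: gmq.
have sg_fix v c : gm c = c -> sg v c = 0.
  move=> gc; rewrite sgE; under eq_bigr do rewrite fixed_iter //.
  by rewrite sumr_const card_ord -mulr_natr (pcharf0 pF) mulr0.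
have Ysg0 : (supp Y :&: sg @: supp X = 0)%VS.
  apply/eqP; rewrite -subv0; apply/subvP => v; rewrite memv_cap memv0.
  case/andP => vY /memv_imgP[u uX uE]; apply/eqP/ffunP => c; rewrite ffunE.
  apply/eqP/negPn/negP => /[dup] vc /(fixE _ _ vY)[_ gc].
  by rewrite uE sg_fix ?eqxx in vc.
have Yta0 : (supp Y :&: ta @: supp X = 0)%VS.
  apply/eqP; rewrite -subv0; apply/subvP => v; rewrite memv_cap memv0.
  case/andP => vY /memv_imgP[u uX uE]; apply/eqP/ffunP => c; rewrite ffunE.
  apply/eqP/negPn/negP => /[dup] vc /(fixE _ _ vY)[_ gc].
  by rewrite uE taE gc subrr eqxx in vc.
have kta : (supp X :&: lker ta = supp Y + sg @: supp X)%VS.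
  apply/eqP; rewrite eqEsubv; apply/andP; split; last first.
    rewrite subv_add !subv_cap supp_sub /=; apply/and3P; split.
    - apply/subvP => v vY; rewrite memv_ker; apply/eqP/ffunP => c; rewrite taE ffunE.
      have [/eqP v0|/(fixE _ _ vY)[_ ->]] := boolP (v c == 0); last by rewrite subrr.
      have [/eqP ->|/(fixE _ _ vY)[_ /gm_inj gc]] := boolP (v (gm c) == 0).
        by rewrite v0 subr0.
      by rewrite gc subrr.
    - by apply/subvP => _ /memv_imgP[v vX ->]; apply: sg_supp.
    apply/subvP => _ /memv_imgP[v vX ->]; rewrite memv_ker; apply/eqP/ffunP => c.
    by rewrite taE sg_inv // subrr ffunE.
  apply/subvP => v; rewrite memv_cap memv_ker => /andP[/suppP vX /eqP/ffunP tv].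
  have v_gm c : v (gm c) = v c by have := tv c; rewrite taE ffunE => /eqP; rewrite subr_eq0 => /eqP.
  have v_iter k c : v (iter k gm c) = v c by elim: k => //= k IHk; rewrite v_gm.
  (* An invariant [v] is constant on orbits: [w] is its part on fixed chains, and [b] keeps its
     value at one root per free orbit, so that the norm of [b] restores the rest. *)
  pose b : V := [ffun c => if (gm c != c) && (froot gm c == c) then v c else 0].
  pose w : V := [ffun c => if gm c == c then v c else 0].
  have -> : v = w + sg b.
    apply/ffunP => c; rewrite ffunE sgE [w c]ffunE.
    have [cX|cX] := boolP (c \in chains lt X); last first.
      rewrite vX // if_same add0r big1 // => i _; rewrite ffunE.
      by rewrite v_iter vX // if_same.
    case: ifPn => [/eqP gc|ngc].
      rewrite big1 ?addr0 // => i _; by rewrite fixed_iter // ffunE gc eqxx.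
    rewrite add0r; have [i iE iu] := root_once gm_inj p_prime (gm_p cX) ngc.
    have rt k : froot gm (iter k gm c) = froot gm c.
      apply/eqP; rewrite (root_connect (fconnect_sym gm_inj)).
      by rewrite (fconnect_sym gm_inj) fconnect_iter.
    have ngk k : gm (iter k gm c) != iter k gm c.
      have inj_iter m : injective (iter m gm) by elim: m => // m IHm x y /= /gm_inj/IHm.
      have -> : gm (iter k gm c) = iter k gm (gm c) by exact: (iterSr k gm c).
      by rewrite (inj_eq (inj_iter k)).
    rewrite (bigD1 i) //= big1 ?addr0 => [|j ji].
      by rewrite ffunE ngk rt -iE eqxx v_iter.
    rewrite ffunE ngk rt; case: eqP => // /esym/iu jE; by rewrite jE eqxx in ji.
  apply: memv_add.
    apply/suppP => c cY; rewrite ffunE; case: eqP => // /eqP gc.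
    apply: vX; apply: contra cY => cX; by rewrite (chains_fixed cX) gc.
  apply/memv_img/suppP => c cX; rewrite ffunE; case: ifP => // _; exact: vX.
have := exact_fixed_subspace tad sgd exC (d_supp Y) supp_sub Ysg taC tasg kta Ysg0 Yta0.
move=> /subvP exY f fY f0.
pose fv : V := [ffun c => f c].
have fvY : fv \in supp Y by apply/suppP => c /fY; rewrite ffunE.
have fYd : fv \in (supp Y :&: lker d)%VS.
  rewrite memv_cap fvY memv_ker; apply/eqP/ffunP => c; rewrite bdE [RHS]ffunE -[RHS](f0 c).
  by apply: eq_bd => e; rewrite ffunE.
case/memv_imgP: (exY _ fYd) => u /suppP uY uE; exists u => // c.
by have /ffunP/(_ c) := uE; rewrite bdE ffunE.
Qed.

End Smith.

(** * Lefschetz numbers *)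

(** For a generalised inverse s of [M], the rows of 1 - M s are cycles, hence lie in the row space
    of [M]; this makes (1 - M s) s a contracting homotopy. *)
Lemma homotopy_of_exact (F : fieldType) n (M : 'M[F]_n) :
  M *m M = 0 -> (forall u : 'rV_n, u *m M = 0 -> exists w, w *m M = u) ->
  exists h : 'M_n, M *m h + h *m M = 1%:M.
Proof.
move=> MM ex; set s := pinvmx M; have MsM : M *m s *m M = M by rewrite mulmxKpV.
have kM : (1%:M - M *m s <= M)%MS.
  apply/row_subP => i; have [|w <-] := ex (row i (1%:M - M *m s)); last exact: submxMl.
  by rewrite -row_mul mulmxBl mul1mx MsM subrr row0.
exists ((1%:M - M *m s) *m s).
rewrite (mulmxKpV kM) mulmxBl mul1mx mulmxBr !mulmxA MM !mul0mx subr0.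
by rewrite addrC subrK.
Qed.

(* A homotopy modulo p lifts to an integral h; then D = M h + h M commutes with M and is
   invertible over the rationals, since \det D = 1 mod p, so that M is split exact there. *)
Lemma supertrace_eq0 p n (M G S : 'M[int]_n) : prime p ->
  (forall u : 'rV['F_p]_n, u *m map_mx intr M = 0 ->
     exists w, w *m map_mx intr M = u) ->
  M *m M = 0 -> M *m G = G *m M -> S *m M = - (M *m S) ->
  \tr (S *m G) = 0.
Proof.
move=> p_pr ex MM MG SM.
pose fp := intr : int -> 'F_p; pose fq := intr : int -> rat.
have [||h hE] := @homotopy_of_exact 'F_p n (map_mx fp M).
- by rewrite -map_mxM MM map_mx0.
- exact: ex.
pose hz : 'M[int]_n := map_mx (fun x : 'F_p => (x : nat)%:Z) h.
have hzE : map_mx fp hz = h.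
  by apply/matrixP => i j; rewrite !mxE /fp /= -pmulrn natr_Zp.
pose D := M *m hz + hz *m M.
have detD : \det D != 0.
  apply/eqP => /(congr1 fp); rewrite /fp -det_map_mx map_mxD !map_mxM /= -/fp hzE hE.
  by rewrite det1 => /eqP; rewrite oner_eq0.
have DM : D *m M = M *m D.
  by rewrite mulmxDl mulmxDr !mulmxA MM mul0mx add0r -!mulmxA MM mulmx0 addr0.
pose M' := map_mx fq M; pose G' := map_mx fq G; pose S' := map_mx fq S.
pose h' := map_mx fq hz; pose D' := map_mx fq D.
have D'E : D' = M' *m h' + h' *m M' by rewrite /D' map_mxD !map_mxM.
have uD : D' \in unitmx.
  by rewrite unitmxE det_map_mx unitfE /fq intr_eq0.
have DM' : D' *m M' = M' *m D' by rewrite -!map_mxM DM.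
have ZM : invmx D' *m M' = M' *m invmx D'.
  by rewrite -[LHS]mulmx1 -(mulmxV uD) mulmxA -[X in X *m _]mulmxA -DM' !mulmxA mulVmx // mul1mx.
have MG' : M' *m G' = G' *m M' by rewrite -!map_mxM MG.
have SM' : S' *m M' = - (M' *m S') by rewrite -!map_mxM SM map_mxN.
(* Insert D'^-1 D' and expand D' = M' h' + h' M'. The two traces are opposite: cyclicity brings [M']
   in front of [S'], passing [S'] changes the sign, and [M'] commutes with [G'] and D'^-1. *)
have tr0 : \tr (S' *m G') = 0.
  rewrite -[S' *m G']mulmx1 -(mulVmx uD) {2}D'E !mulmxDr mxtraceD !mulmxA.
  rewrite [X in _ + X]mxtrace_mulC !mulmxA.
  have -> : M' *m S' = - (S' *m M') by rewrite SM' opprK.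
  rewrite !mulNmx raddfN -(mulmxA (S' *m G')) ZM mulmxA -(mulmxA S' G') -MG' !mulmxA.
  by rewrite subrr.
apply/eqP; rewrite -(intr_eq0 rat); apply/eqP; rewrite -[RHS]tr0.
by rewrite -map_mxM trace_map_mx.
Qed.

Section Lefschetz.
Variables (T : finType) (lt : rel T).
Hypotheses (lt_irr : irreflexive lt) (lt_trans : transitive lt).
Variables (g : T -> T).
Hypotheses (g_inj : injective g) (g_lt : forall x y, lt (g x) (g y) = lt x y).
Variable X : {set T}.
Hypothesis gX : {in X, forall x, g x \in X}.
Implicit Types (c d : {set T}).

Local Notation n := #|chains lt X|.
Local Notation ch := (fun i : 'I_n => enum_val i).

Section Vec.
Variable R : comNzRingType.
Implicit Types f : {set T} -> R.

Definition chain_vec f : 'rV[R]_n := \row_i f (ch i).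

Definition bd_mx : 'M[R]_n :=
  \matrix_(i, j) \sum_(x | x \notin ch j) sgn_in lt R x (ch j) * (ch i == x |: ch j)%:R.

Definition chain_delta (c d : {set T}) : R := (d == c)%:R.

Lemma sum_chains_delta f c : supported lt X f ->
  \sum_(i < n) f (ch i) * (ch i == c)%:R = f c.
Proof.
move=> fX; rewrite -(big_enum_val (fun d => f d * (d == c)%:R)) /=.
have [cX|cX] := boolP (c \in chains lt X).
  rewrite (bigD1 c) //= eqxx mulr1 big1 ?addr0 // => d /andP[_ /negbTE->].
  by rewrite mulr0.
rewrite fX // big1 // => d dX; case: eqP => [dc|]; last by rewrite mulr0.
by rewrite -dc dX in cX.
Qed.

Lemma chain_vec_bd f : supported lt X f -> chain_vec f *m bd_mx = chain_vec (bd lt f).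
Proof.
move=> fX; apply/rowP => j; rewrite !mxE /bd.
under eq_bigr do rewrite !mxE big_distrr.
rewrite exchange_big; apply: eq_bigr => x _ /=.
under eq_bigr do rewrite mulrCA.
by rewrite -big_distrr /= sum_chains_delta.
Qed.

Lemma supported_delta i : supported lt X (chain_delta (ch i)).
Proof.
move=> c cX; rewrite /chain_delta; case: eqP => // ci.
by rewrite ci enum_valP in cX.
Qed.

Lemma chain_vec_delta i : chain_vec (chain_delta (ch i)) = delta_mx 0 i.
Proof.
apply/rowP => j; rewrite !mxE eqxx /chain_delta (inj_eq enum_val_inj) eq_sym.
by rewrite eq_sym.
Qed.

Lemma chain_mxP m (A B : 'M[R]_(n, m)) :
  (forall f, supported lt X f -> chain_vec f *m A = chain_vec f *m B) -> A = B.
Proof.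
move=> AB; apply/row_matrixP => i; rewrite !rowE -chain_vec_delta.
exact: AB (supported_delta i).
Qed.

Lemma bd_mx_sq : bd_mx *m bd_mx = 0.
Proof.
apply: chain_mxP => f fX; rewrite mulmx0 mulmxA !chain_vec_bd //; last exact: supported_bd.
by apply/rowP => j; rewrite !mxE (bd_bd lt_irr lt_trans fX).
Qed.

Definition chain_act_mx : 'M[R]_n := \matrix_(i, j) (ch i == g @: ch j)%:R.

Lemma chain_vec_act f : supported lt X f ->
  chain_vec f *m chain_act_mx = chain_vec (fun c => f (g @: c)).
Proof.
move=> fX; apply/rowP => j; rewrite !mxE.
under eq_bigr do rewrite !mxE.
by rewrite sum_chains_delta.
Qed.

Definition chain_sign_mx : 'M[R]_n := diag_mx (\row_i (-1) ^+ #|ch i|).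

Lemma chain_vec_sign f :
  chain_vec f *m chain_sign_mx = chain_vec (fun c => (-1) ^+ #|c| * f c).
Proof. by rewrite mul_mx_diag; apply/rowP => j; rewrite !mxE mulrC. Qed.

Lemma bd_sign f c :
  bd lt (fun d => (-1) ^+ #|d| * f d) c = - ((-1) ^+ #|c| * bd lt f c).
Proof.
rewrite /bd big_distrr -sumrN; apply: eq_bigr => x xc.
by rewrite cardsU1 xc add1n exprS /=; ring.
Qed.

End Vec.

Lemma chains_unimset c : (g @: c \in chains lt X) -> c \in chains lt X.
Proof.
move=> gcX; have gi := imset_inj g_inj.
have [k ck] : exists k, iter k.+1 (fun d : {set T} => g @: d) c = c.
  exists (fingraph.order (fun d : {set T} => g @: d) c).-1.
  by rewrite prednK ?fingraph.order_gt0 //; exact: (iter_order gi).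
rewrite -ck iterSr; elim: k {ck} => //= k; exact: chains_imset.
Qed.

Lemma supported_act (R : comNzRingType) (f : {set T} -> R) :
  supported lt X f -> supported lt X (fun c => f (g @: c)).
Proof. by move=> fX c cX; apply: fX; apply: contra cX; apply: chains_unimset. Qed.

(** The supertrace of the action of [g] counts with sign the chains mapped to themselves, which are
    the chains of fixed points. It vanishes by [supertrace_eq0]: the action commutes with the
    boundary and the sign matrix anticommutes with it. *)
Theorem lefschetz p : prime p -> exact_poset lt 'F_p X ->
  \sum_(c in chains lt (fixed g X)) (-1) ^+ #|c| = 0 :> int.
Proof.
move=> p_pr exX.
have map_bd : map_mx intr (bd_mx int) = bd_mx 'F_p.
  apply/matrixP => i j; rewrite !mxE rmorph_sum; apply: eq_bigr => x _.
  by rewrite rmorphM /sgn_in rmorphXn rmorphN1 /= rmorph_nat.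
transitivity (\tr (chain_sign_mx int *m chain_act_mx int)).
  rewrite mul_diag_mx /mxtrace; under [RHS]eq_bigr do rewrite !mxE.
  rewrite -(big_enum_val (fun c => (-1) ^+ #|c| * (c == g @: c)%:R)) /=.
  rewrite [RHS](bigID (fun c => g @: c == c)) /= [X in _ = _ + X]big1 ?addr0.
    apply: eq_big => [c|c]; last first.
      rewrite inE => /andP[cX cc].
      have cX' : c \in chains lt X by rewrite inE cc andbT (subset_trans cX) ?fixed_sub.
      have := chains_fixed lt_irr lt_trans g_inj g_lt cX'; rewrite inE cX cc /= eq_sym.
      by move=> <-; rewrite mulr1.
    have [cX|cX] := boolP (c \in chains lt X).
      by rewrite (chains_fixed lt_irr lt_trans g_inj g_lt cX).
    by apply: contraNF cX; apply: chains_mono; apply: fixed_sub.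
  by move=> c /andP[_]; rewrite eq_sym => /negbTE->; rewrite mulr0.
apply: (@supertrace_eq0 p _ (bd_mx int)) => //.
- move=> u; rewrite map_bd => u0.
  pose f c : 'F_p := \sum_(i | ch i == c) u 0 i.
  have fu : chain_vec f = u.
    apply/rowP => i; rewrite !mxE /f (bigD1 i) //= big1 ?addr0 // => j /andP[/eqP ji].
    by rewrite (enum_val_inj ji) eqxx.
  have fX : supported lt X f.
    move=> c cX; rewrite /f big_pred0 // => i; apply: contraNF cX => /eqP <-.
    exact: enum_valP.
  have [|w wX wE] := exX f fX.
    move=> c; have [cX|cX] := boolP (c \in chains lt X); last by rewrite (supported_bd fX).
    have := u0; rewrite -fu chain_vec_bd // => /rowP/(_ (enum_rank_in cX c)).
    by rewrite !mxE enum_rankK_in.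
  exists (chain_vec w); rewrite chain_vec_bd // -fu.
  by apply/rowP => i; rewrite !mxE wE.
- exact: bd_mx_sq.
- apply: chain_mxP => f fX; rewrite !mulmxA chain_vec_bd // !chain_vec_act //; last first.
    exact: supported_bd.
  rewrite chain_vec_bd; last exact: supported_act.
  by apply/rowP => j; rewrite !mxE bd_imset.
- apply: chain_mxP => f fX; rewrite mulmxN !mulmxA chain_vec_bd // !chain_vec_sign.
  rewrite chain_vec_bd => [|c cX]; last by rewrite fX // mulr0.
  by apply/rowP => j; rewrite !mxE bd_sign.
Qed.

End Lefschetz.

(** The hypothesis makes [w] the Möbius function from an adjoined bottom element, and the identity
    is Philip Hall's theorem. A maximal [x] is removed; the chains through it correspond to the
    chains of elements below it. *)
Lemma sum_chains_weight (T : finType) (lt : rel T) (lt_irr : irreflexive lt)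
    (lt_trans : transitive lt) (w : T -> int) (X : {set T}) :
  {in X, forall x, 1 + \sum_(y in X | lt y x) w y = - w x} ->
  \sum_(c in chains lt X) (-1) ^+ #|c| = 1 + \sum_(y in X) w y.
Proof.
have [n] := ubnP #|X|; elim: n X => // n IHn X; rewrite ltnS => Xn wX.
have [X0|[x0 x0X]] := set_0Vmem X.
  rewrite X0 big_set0 addr0 (bigD1 set0) /=; last first.
    by rewrite inE sub0set; apply/chainP => x y; rewrite inE.
  rewrite cards0 expr0 big1 ?addr0 // => c /andP[].
  by rewrite inE subset0 => /andP[/eqP-> _]; rewrite eqxx.
(* The number of elements below is strictly increasing along [lt], so its maximiser is a maximal
   element. *)
pose x := [arg max_(y > x0 in X) #|[set z in X | lt z y]|]%N.
have [xX xmax] : x \in X /\ {in X, forall y, ~~ lt x y}.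
  rewrite /x; case: arg_maxnP => // y yX ymax; split=> // z zX.
  apply/negP => yz; have := ymax z zX; rewrite /= leqNgt; case/negP.
  apply: proper_card; rewrite properE; apply/andP; split.
    by apply/subsetP => u; rewrite !inE => /andP[-> /lt_trans->].
  by apply/subsetPn; exists y; rewrite !inE yX // lt_irr.
have LE : link lt X x = [set y in X | lt y x].
  by apply/setP => y; rewrite !inE; case: (boolP (y \in X)) => //= /xmax/negbTE->; rewrite orbF.
rewrite (bigID (fun c : {set T} => x \in c)) /= addrC.
have -> : \sum_(c in chains lt X | x \notin c) (-1) ^+ #|c|
    = \sum_(c in chains lt (X :\ x)) (-1) ^+ #|c| :> int.
  by apply: eq_bigl => c; rewrite !inE subsetD1 andbAC.
have -> : \sum_(c in chains lt X | x \in c) (-1) ^+ #|c|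
    = - \sum_(c in chains lt (link lt X x)) (-1) ^+ #|c| :> int.
  rewrite (reindex_onto (fun c => x |: c) (fun c => c :\ x)) /=; last first.
    by move=> c /andP[_ xc]; rewrite setD1K.
  rewrite -sumrN; apply: eq_big => [c|c /andP[_ /eqP cE]].
    rewrite setU11 andbT; have [xc|xc] := boolP (x \in c).
      rewrite [(_ |: _) :\ _ == _](_ : _ = false) ?andbF; last first.
        by apply/negP => /eqP cE; rewrite -cE !inE eqxx in xc.
      by rewrite !inE; apply/esym/negP => /andP[/subsetP/(_ x xc)]; rewrite !inE lt_irr andbF.
    by rewrite chainsU1 // setU1K // eqxx andbT.
  have xc : x \notin c by rewrite -cE !inE eqxx.
  by rewrite cardsU1 xc add1n exprS mulN1r.
rewrite IHn; last first.
- move=> y; rewrite !inE => /andP[yx yX]; rewrite -(wX y yX); congr (1 + _).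
  apply: eq_bigl => z; rewrite !inE; case: eqP => //= ->.
  by rewrite (negbTE (xmax _ yX)) andbF.
- by move: Xn; rewrite (cardsD1 x) xX.
rewrite LE IHn; last first.
- move=> y; rewrite inE => /andP[yX yx]; rewrite -(wX y yX); congr (1 + _).
  apply: eq_bigl => z; rewrite !inE; case: (boolP (lt z y)) => zy; rewrite ?andbF // !andbT.
  by rewrite (lt_trans _ _ _ zy yx) andbT.
- apply: leq_trans Xn; apply: proper_card; rewrite properE; apply/andP; split.
    by apply/subsetP => y; rewrite inE => /andP[].
  by apply/subsetPn; exists x; rewrite // !inE lt_irr andbF.
rewrite (bigD1 x xX) /= -addrA; congr (1 + _); rewrite addrC; congr (_ + _); last first.
  by apply: eq_bigl => y; rewrite !inE andbC.
rewrite -[RHS]opprK -(wX x xX); congr (- (1 + _)).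
by apply: eq_bigl => y; rewrite !inE.
Qed.

(** * Fixed graphs and orbits of edges *)

Section MoveGraph.
Variable n : nat.
Implicit Types (s : 'S_n) (e : edge n) (G H : graph n).

Lemma card_edge_image s e : #|s @: val e| == 2.
Proof. by rewrite card_imset ?(valP e) //; apply: perm_inj. Qed.

Definition edge_image s e : edge n := Sub (s @: val e) (card_edge_image s e).

Definition move_graph s G : graph n := edge_image s @: G.

Lemma edge_image_inj s : injective (edge_image s).
Proof. by move=> e f /(congr1 val)/= /(imset_inj (@perm_inj _ s))/val_inj. Qed.

Lemma move_graph_inj s : injective (move_graph s).
Proof. exact: imset_inj (@edge_image_inj s). Qed.

Lemma edge_endpoints e : exists x y, x != y /\ val e = [set x; y].
Proof. by have /cards2P := valP e. Qed.

Lemma edge_imageE s e x y : val e = [set x; y] -> val (edge_image s e) = [set s x; s y].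
Proof. by move=> eE; rewrite /= eE imsetU1 imset_set1. Qed.

Lemma isomorphic_move s G : isomorphic G (move_graph s G).
Proof.
apply/existsP; exists s; apply/forallP => x; apply/forallP => y; apply/eqP.
apply/exists_inP/exists_inP => [[e eG /eqP eE]|[_ /imsetP[e eG ->]]].
  by exists (edge_image s e); rewrite ?imset_f // (edge_imageE _ eE).
move=> eE; exists e => //; apply/eqP/(imset_inj (@perm_inj _ s)).
by rewrite imsetU1 imset_set1; apply/eqP.
Qed.

Lemma move_graph_subset s G H : (move_graph s G \subset move_graph s H) = (G \subset H).
Proof.
apply/idP/idP => [/subsetP sGH|]; last exact: imsetS.
apply/subsetP => e eG; have := sGH (edge_image s e) (imset_f _ eG).
by rewrite mem_imset //; apply: edge_image_inj.
Qed.

Lemma move_graph_psub s G H : psub _ (move_graph s G) (move_graph s H) = psub _ G H.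
Proof. by rewrite /psub !properE !move_graph_subset. Qed.

Lemma iter_edge_image m s e : val (iter m (edge_image s) e) = [set iter m s x | x in val e].
Proof.
elim: m => [|m IHm] /=; first by rewrite imset_id.
by rewrite IHm -imset_comp.
Qed.

Lemma iter_move_graph m s G : iter m (move_graph s) G = [set iter m (edge_image s) e | e in G].
Proof.
elim: m => [|m IHm] /=; first by rewrite imset_id.
by rewrite IHm /move_graph -imset_comp.
Qed.

Lemma iter_move_graph_id m s G : (forall x, iter m s x = x) -> iter m (move_graph s) G = G.
Proof.
move=> sm; rewrite iter_move_graph -[RHS]imset_id; apply: eq_imset => e.
apply: val_inj; rewrite iter_edge_image -[RHS]imset_id; exact: eq_imset.
Qed.

Lemma move_graph_conj m (a b : 'S_n) G : (forall x, a (b x) = b (iter m a x)) ->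
  move_graph a (move_graph b G) = move_graph b (iter m (move_graph a) G).
Proof.
move=> ab; rewrite iter_move_graph /move_graph -!imset_comp; apply: eq_imset => e.
apply: val_inj; rewrite /= iter_edge_image -!imset_comp; exact: eq_imset.
Qed.

Lemma mem_iter_fixed m s G e : move_graph s G = G ->
  (iter m (edge_image s) e \in G) = (e \in G).
Proof.
move=> sG; elim: m => //= m <-; rewrite -{1}sG mem_imset //; exact: edge_image_inj.
Qed.

Lemma monotone_subset (P : {set graph n}) G H :
  monotone P -> G \subset H -> H \in P -> G \in P.
Proof.
move=> Pm GH HP; have [k] := ubnP #|H :\: G|; elim: k H GH HP => // k IHk H GH HP.
rewrite ltnS => Hk; have [HG|[e]] := set_0Vmem (H :\: G).
  suff -> : G = H by [].
  by apply/eqP; rewrite eqEsubset GH -setD_eq0 HG eqxx.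
rewrite inE => /andP[eG eH]; apply: (IHk (H :\ e)); last 1 first.
- apply: leq_trans Hk; rewrite [X in (_ < X)%N](cardsD1 e) inE eG eH add1n ltnS.
  by apply: subset_leq_card; apply/subsetP => x; rewrite !inE => /and3P[-> -> ->].
- by rewrite subsetD1 GH.
- exact: Pm.
Qed.

End MoveGraph.

(* Oliver's fixed point theorem for the group generated by a and b: its normal p-subgroup
   is <a>, with cyclic quotient generated by b. *)
Theorem fixed_points_euler n (P : {set graph n}) (t : strategy n) (A : graph n)
    p m (a b : 'S_n) :
  graph_property P -> monotone P -> A \in P -> (questions t < #|~: A|)%N ->
  (forall H : graph n, A \subset H -> run t H = (H \in P)) ->
  prime p -> (forall x, iter p a x = x) -> (forall x, a (b x) = b (iter m a x)) ->
  move_graph a A = A -> move_graph b A = A ->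
  \sum_(c in chains (psub _) [set H in P | [&& A \proper H, move_graph a H == H
      & move_graph b H == H]]) (-1) ^+ #|c| = 0 :> int.
Proof.
move=> Pprop Pmono PA tA tP p_pr ap ab aA bA.
have Pdown (G H : graph n) : G \subset H -> H \in P -> G \in P by apply: monotone_subset.
set X := faces_above P A (~: A).
have stable s : move_graph s A = A -> {in X, forall H, move_graph s H \in X}.
  move=> sA H; rewrite !inE setUCr => /and3P[HP AH _].
  rewrite (Pprop _ _ (isomorphic_move s H) HP) subsetT andbT /=.
  by rewrite -{1}sA -/(psub _ _ _) move_graph_psub.
have exX : exact_poset (psub _) 'F_p X.
  apply: (exact_nonevasive Pdown (t := t)) => //; last by move=> H /tP.
  by rewrite disjoints_subset setCK.
have aX := stable a aA.
have exY := smith (@psub_irr _) (@psub_trans _) (@move_graph_inj _ a)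
  (@move_graph_psub _ a) p_pr (pchar_Fp p_pr) aX
  (fun G _ => iter_move_graph_id G ap) exX.
have bY : {in fixed (move_graph a) X, forall H, move_graph b H \in fixed (move_graph a) X}.
  move=> H /setIdP[HX /eqP aH]; apply/setIdP; split; first exact: stable.
  rewrite (move_graph_conj H ab); apply/eqP; congr (move_graph b _).
  by elim: m {ab} => //= k ->.
rewrite (_ : [set H in P | _] = fixed (move_graph b) (fixed (move_graph a) X)).
  have E := lefschetz (@psub_irr _) (@psub_trans _) (@move_graph_inj _ b)
    (@move_graph_psub _ b) bY p_pr exY.
  exact E.
by apply/setP => H; rewrite !inE setUCr subsetT andbT !andbA.
Qed.

(** * Alternating sums over unions of orbits *)

Fixpoint bits k : seq bitseq :=
  if k is k'.+1 then [seq true :: s | s <- bits k'] ++ [seq false :: s | s <- bits k']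
  else [:: [::]].

Lemma mem_bits k s : (s \in bits k) = (size s == k).
Proof.
elim: k s => [|k IHk] [|b s] //=.
  by rewrite mem_cat; apply/norP; split; apply/negP => /mapP[].
rewrite mem_cat eqSS -IHk; case: b.
  rewrite mem_map => [|? ? []//]; rewrite (_ : _ \in map _ _ = false) ?orbF //.
  by apply/negP => /mapP[].
rewrite orbC mem_map => [|? ? []//]; rewrite (_ : _ \in map _ _ = false) ?orbF //.
by apply/negP => /mapP[].
Qed.

Lemma uniq_bits k : uniq (bits k).
Proof.
elim: k => //= k IHk; rewrite cat_uniq !map_inj_uniq ?IHk => [|? ? []|? ? []] //.
by rewrite andbT; apply/hasPn => _ /mapP[s _ ->]; apply/negP => /mapP[].
Qed.

Notation bit_le := (all2 implb).

Lemma sum_bits_le s :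
  \sum_(c <- bits (size s) | bit_le c s) (-1) ^+ count id c = (~~ has id s)%:R :> int.
Proof.
elim: s => [|b s IHs]; first by rewrite big_cons big_nil.
rewrite /= big_cat !big_map /=; case: b => /=; rewrite ?IHs.
  under eq_bigr do rewrite add1n exprS mulN1r.
  by rewrite sumrN IHs addNr.
by rewrite big_pred0 // add0r.
Qed.

Lemma bit_le_refl s : bit_le s s.
Proof. by elim: s => //= b s ->; rewrite implybb. Qed.

Lemma bit_le_anti s s' : bit_le s s' -> bit_le s' s -> s = s'.
Proof.
elim: s s' => [|b s IHs] [|b' s'] //= /andP[bb' /IHs h] /andP[b'b /h ->].
by case: b b' bb' b'b => [] [].
Qed.

Lemma bit_le0 s : bit_le (nseq (size s) false) s.
Proof. by elim: s. Qed.

Lemma none_nseq s : ~~ has id s = (s == nseq (size s) false).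
Proof. by elim: s => //= b s; rewrite negb_or eqseq_cons => ->; case: b. Qed.

(** P is closed downwards, so below each member the intervals are Boolean and (-1)^(number of
    orbits) satisfies the recursion of [sum_chains_weight]. The bottom union is not in [Y]; its
    weight 1 on the right is the term 1 of that lemma. *)
Lemma sum_orbit_weights (E : finType) (P Y : {set {set E}}) k (U : bitseq -> {set E}) :
  {in bits k &, forall s s', (U s \subset U s') = bit_le s s'} ->
  (forall G H : {set E}, G \subset H -> H \in P -> G \in P) ->
  U (nseq k false) \in P ->
  {in bits k, forall s, (U s \in Y) = has id s && (U s \in P)} ->
  (forall H, H \in Y -> exists2 s, s \in bits k & H = U s) ->
  \sum_(c in chains (psub E) Y) (-1) ^+ #|c| =
    \sum_(s <- bits k | U s \in P) (-1) ^+ count id s :> int.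
Proof.
move=> Ule Pdown U0 UY YU.
have Uinj : {in bits k &, injective U}.
  move=> s s' sk s'k UE; apply: bit_le_anti; rewrite -Ule // UE; exact: subxx.
pose w G : int := \sum_(s <- bits k | U s == G) (-1) ^+ count id s.
have wU s : s \in bits k -> w (U s) = (-1) ^+ count id s.
  move=> sk; rewrite /w big_seq_cond (eq_bigl (fun c => (c \in bits k) && (c == s))).
    rewrite -big_seq_cond big_mkcond (bigD1_seq s) ?uniq_bits //= eqxx.
    by rewrite big1 ?addr0 // => c /negbTE->.
  move=> c; apply: andb_id2l => ck; exact: (inj_in_eq Uinj).
have sumw (Q : pred {set E}) : \sum_(G in Y | Q G) w G =
    \sum_(s <- bits k | (U s \in Y) && Q (U s)) (-1) ^+ count id s.
  rewrite /w (exchange_big_dep predT) //= [RHS]big_mkcond; apply: eq_bigr => s _.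
  have [h|h] := boolP ((U s \in Y) && Q (U s)).
    rewrite (big_pred1 (U s)) // => G /=; rewrite eq_sym.
    by case: (G =P U s) => [->|]; rewrite ?h ?andbF.
  rewrite big_pred0 // => G; case: (U s =P G) => [<-|]; rewrite ?andbF // andbT.
  exact/negbTE.
have k0 : nseq k false \in bits k by rewrite mem_bits size_nseq.
have c0 : count id (nseq k false) = 0%N by rewrite count_nseq.
rewrite (sum_chains_weight (w := w) (@psub_irr _) (@psub_trans _)).
  have := sumw predT; rewrite (eq_bigl (fun G => G \in Y)) => [->|G]; last by rewrite andbT.
  rewrite [RHS]big_mkcond (bigD1_seq (nseq k false)) ?uniq_bits //= U0 c0 expr0.
  congr (1 + _); rewrite -big_mkcondr /= [LHS]big_seq_cond [RHS]big_seq_cond.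
  apply: eq_bigl => s; apply: andb_id2l => sk; rewrite UY // andbT; congr (_ && _).
  by rewrite -[LHS]negbK none_nseq; move: sk; rewrite mem_bits => /eqP->.
move=> G GY; have [s sk GE] := YU G GY.
rewrite {}GE in GY *; rewrite sumw wU //.
have [hs sP] : has id s /\ U s \in P by apply/andP; rewrite -UY.
have sz : size s = k by apply/eqP; rewrite -mem_bits.
have s0 : nseq k false != s by rewrite -sz eq_sym -none_nseq hs.
have := sum_bits_le s; rewrite hs sz big_mkcond (bigD1_seq s) ?uniq_bits //= bit_le_refl.
rewrite big_mkcond (bigD1_seq (nseq k false)) ?uniq_bits //= s0 -{1}sz bit_le0 c0 expr0.
rewrite addrC => /eqP; rewrite addr_eq0 => /eqP <-; congr (1 + _).
rewrite -!big_mkcondr /= [LHS]big_seq_cond [RHS]big_seq_cond.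
apply: eq_bigl => c; apply: andb_id2l => ck; rewrite UY // /psub properE !Ule //.
have -> : (c != nseq k false) = has id c.
  by rewrite -[RHS]negbK none_nseq; move: ck; rewrite mem_bits => /eqP->.
case: (boolP (bit_le c s)) => cs; rewrite ?andbF //= !andbT.
have -> : U c \in P by apply: Pdown sP; rewrite Ule.
rewrite andbT; congr (_ && _); apply/idP/idP; first by apply: contraNneq => ->; apply: bit_le_refl.
by apply: contra => sc; apply/eqP/bit_le_anti.
Qed.

Lemma set2_eq (T : finType) (x y u v : T) : [set x; y] = [set u; v] ->
  x = u /\ y = v \/ x = v /\ y = u.
Proof.
move=> e; have : x \in [set u; v] by rewrite -e set21.
have : y \in [set u; v] by rewrite -e set22.
have : u \in [set x; y] by rewrite e set21.
have : v \in [set x; y] by rewrite e set22.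
by do 4![case/set2P => ?]; (left; split; congruence) || (right; split; congruence).
Qed.

Section GraphOf.
Variable n : nat.
Implicit Types (e : edge n) (G : graph n) (r : rel 'I_n).

Lemma ex_edge (x y : 'I_n) : x != y -> exists e, val e = [set x; y].
Proof.
move=> xy; have h : #|[set x; y]| == 2%N by rewrite cards2 xy.
by exists (Sub [set x; y] h).
Qed.

Lemma mem_graph_of r e x y : val e = [set x; y] -> (e \in graph_of r) = r x y || r y x.
Proof.
move=> eE; rewrite inE; apply/existsP/idP => [[u /existsP[v /andP[/eqP]]]|].
  by rewrite eE => /set2_eq[[-> ->] ->|[-> ->] ->]; rewrite ?orbT.
case/orP => h; first by exists x; apply/existsP; exists y; rewrite eE eqxx.
by exists y; apply/existsP; exists x; rewrite eE setUC eqxx.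
Qed.

Lemma mem_adj G e x y : val e = [set x; y] -> adj G x y = (e \in G).
Proof.
move=> eE; apply/exists_inP/idP => [[f fG /eqP fE]|eG].
  by rewrite (_ : e = f) //; apply: val_inj; rewrite fE.
by exists e => //; apply/eqP.
Qed.

Lemma adj_graph_of r x y : x != y -> adj (graph_of r) x y = r x y || r y x.
Proof. by move=> /ex_edge[e eE]; rewrite (mem_adj _ eE) (mem_graph_of _ eE). Qed.

Lemma move_graph_fixed (s : 'S_n) G :
  (forall e, (edge_image s e \in G) = (e \in G)) -> move_graph s G = G.
Proof.
move=> sG; apply/esym/eqP; rewrite eq_sym eqEcard card_imset ?leqnn ?andbT.
  by apply/subsetP => _ /imsetP[e eG ->]; rewrite sG.
exact: edge_image_inj.
Qed.

Lemma move_graph_mem (P : {set graph n}) (s : 'S_n) G :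
  graph_property P -> (move_graph s G \in P) = (G \in P).
Proof.
move=> Pprop; apply/idP/idP; last exact: Pprop (isomorphic_move s G).
move/(Pprop _ _ (isomorphic_move s^-1 _)).
rewrite /move_graph -imset_comp (_ : imset _ _ = G) //; rewrite -[RHS]imset_id.
apply: eq_imset => e; apply: val_inj; rewrite /= -imset_comp -[RHS]imset_id.
by apply: eq_imset => x; rewrite /= permK.
Qed.

End GraphOf.

(** * Computable certificates for graphs on ten vertices *)

Definition ngraph (r : nat -> nat -> bool) : graph 10 :=
  graph_of (fun x y : 'I_10 => r x y).

Definition perm_list (l : seq nat) : bool :=
  [&& size l == 10%N, uniq l & all (fun x => x < 10)%N l].

Definition vmap (l : seq nat) (x : 'I_10) : 'I_10 := inord (nth 0%N l x).

Lemma vmapE l x : perm_list l -> vmap l x = nth 0%N l x :> nat.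
Proof.
case/and3P => /eqP sl _ /allP ll; rewrite /vmap inordK //.
by apply: ll; rewrite mem_nth // sl.
Qed.

Lemma vmap_inj l : perm_list l -> injective (vmap l).
Proof.
move=> lP x y /(congr1 val); rewrite /= !vmapE // => /eqP.
case/and3P: lP => /eqP sl ul _; rewrite nth_uniq ?sl //.
by move=> /eqP/val_inj.
Qed.

Definition vperm l (lP : perm_list l) : 'S_10 := perm (vmap_inj lP).

Lemma vpermE l (lP : perm_list l) x : vperm lP x = nth 0%N l x :> nat.
Proof. by rewrite permE vmapE. Qed.

Lemma iter_vpermE l (lP : perm_list l) m x :
  iter m (vperm lP) x = iter m (nth 0%N l) x :> nat.
Proof. by elim: m => //= m IHm; rewrite vpermE IHm. Qed.

Definition all_pairs (f : nat -> nat -> bool) : bool :=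
  all (fun x => all (fun y => (x == y) || f x y) (iota 0 10)) (iota 0 10).

Lemma all_pairsP f (x y : 'I_10) : all_pairs f -> x != y -> f x y.
Proof.
have iota10 (z : 'I_10) : (z : nat) \in iota 0 10 by rewrite mem_iota /= ltn_ord.
move=> /allP h1; have /allP h2 := h1 _ (iota10 x).
by have /orP[/eqP/val_inj->|//] := h2 _ (iota10 y); rewrite eqxx.
Qed.

Definition embed_check (r1 r2 : nat -> nat -> bool) (l : seq nat) : bool :=
  perm_list l && all_pairs (fun x y => r1 x y ==>
    r2 (nth 0%N l x) (nth 0%N l y) || r2 (nth 0%N l y) (nth 0%N l x)).

Definition iso_check (r1 r2 : nat -> nat -> bool) (l : seq nat) : bool :=
  perm_list l && all_pairs (fun x y => r1 x y || r1 y x ==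
    r2 (nth 0%N l x) (nth 0%N l y) || r2 (nth 0%N l y) (nth 0%N l x)).

Lemma embed_mem (P : {set graph 10}) r1 r2 l :
  graph_property P -> monotone P -> embed_check r1 r2 l ->
  ngraph r2 \in P -> ngraph r1 \in P.
Proof.
move=> Pprop Pmono /andP[lP h] r2P; rewrite -(move_graph_mem (vperm lP)) //.
apply: monotone_subset Pmono _ r2P; apply/subsetP => _ /imsetP[e eG ->].
have [x [y [xy eE]]] := edge_endpoints e.
rewrite (mem_graph_of _ (edge_imageE _ eE)) !vpermE; move: eG; rewrite (mem_graph_of _ eE).
case/orP => rxy; first by have := all_pairsP h xy; rewrite rxy.
by rewrite eq_sym in xy; have := all_pairsP h xy; rewrite rxy orbC.
Qed.

Lemma iso_mem (P : {set graph 10}) r1 r2 l :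
  graph_property P -> iso_check r1 r2 l -> (ngraph r1 \in P) = (ngraph r2 \in P).
Proof.
move=> Pprop /andP[lP h]; rewrite -(move_graph_mem (vperm lP)) //; congr (_ \in P).
have sub : move_graph (vperm lP) (ngraph r1) \subset ngraph r2.
  apply/subsetP => _ /imsetP[e eG ->]; have [x [y [xy eE]]] := edge_endpoints e.
  rewrite (mem_graph_of _ (edge_imageE _ eE)) !vpermE -(eqP (all_pairsP h xy)).
  by move: eG; rewrite (mem_graph_of _ eE).
apply/eqP; rewrite eqEsubset sub /=; apply/subsetP => f.
have [e ->] : exists e, f = edge_image (vperm lP) e.
  exists (edge_image (vperm lP)^-1 f); apply: val_inj; rewrite /= -imset_comp -[LHS]imset_id.
  by apply: eq_imset => x; rewrite /= permKV.
have [x [y [xy eE]]] := edge_endpoints e.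
rewrite (mem_graph_of _ (edge_imageE _ eE)) !vpermE -(eqP (all_pairsP h xy)) => rxy.
by apply: imset_f; rewrite (mem_graph_of _ eE).
Qed.

(* Edges with a label not less than [size s] always belong to the union. *)
Definition orbit_union (lab : nat -> nat -> nat) (s : bitseq) (x y : nat) : bool :=
  nth true s (lab x y).

Lemma orbit_union_none lab k :
  ngraph (fun x y => k <= lab x y)%N = ngraph (orbit_union lab (nseq k false)).
Proof.
apply/setP => e; have [x [y [xy eE]]] := edge_endpoints e.
rewrite !(mem_graph_of _ eE) /orbit_union !nth_nseq.
by case: (ltnP (lab x y)); case: (ltnP (lab y x)).
Qed.

(** A certificate that <a> has exponent dividing [p] and is normalised by [b], and that each label
    below [size rep] is exactly one edge orbit, with a representative in [rep]. Here [q] only bounds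
    the powers of [b] searched. *)
Definition orbit_data (p q m : nat) (la lb : seq nat) (lab : nat -> nat -> nat)
    (rep : seq (nat * nat)) : bool :=
  let a := nth 0%N la in let b := nth 0%N lb in
  [&& perm_list la, perm_list lb,
      all (fun x => iter p a x == x) (iota 0 10),
      all (fun x => a (b x) == b (iter m a x)) (iota 0 10),
      all_pairs (fun x y => [&& lab x y == lab y x, lab (a x) (a y) == lab x y
        & lab (b x) (b y) == lab x y]),
      all (fun l => let: (u, v) := nth (0, 0)%N rep l in
        [&& u != v, u < 10, v < 10 & lab u v == l]%N) (iota 0 (size rep))
    & all_pairs (fun x y => (size rep <= lab x y)%N ||
        let: (u, v) := nth (0, 0)%N rep (lab x y) in
        has (fun i => has (fun j =>
          let u' := iter j b (iter i a u) in let v' := iter j b (iter i a v) in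
          (u' == x) && (v' == y) || (u' == y) && (v' == x)) (iota 0 q)) (iota 0 p))].

Lemma bit_leP s s' : size s = size s' ->
  reflect (forall l, (l < size s)%N -> nth true s l -> nth true s' l) (bit_le s s').
Proof.
elim: s s' => [|b s IHs] [|b' s'] //= => [_|[ss']]; first by apply: ReflectT.
apply: (iffP andP) => [[/implyP bb' /(IHs _ ss') h] [|l]|h] //=; first exact: h.
split; first by apply/implyP; apply: (h 0%N).
by apply/(IHs _ ss') => l; apply: (h l.+1).
Qed.

Lemma bit_le_nseq0 s : bit_le s (nseq (size s) false) = ~~ has id s.
Proof. by elim: s => //= b s ->; case: b. Qed.

Theorem orbit_equation (P : {set graph 10}) (t : strategy 10) p q m la lb lab rep :
  graph_property P -> monotone P ->
  prime p -> orbit_data p q m la lb lab rep ->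
  let A := ngraph (fun x y => size rep <= lab x y)%N in
  A \in P -> (questions t < #|~: A|)%N ->
  (forall H : graph 10, A \subset H -> run t H = (H \in P)) ->
  \sum_(s <- bits (size rep) | ngraph (orbit_union lab s) \in P)
    (-1) ^+ count id s = 0 :> int.
Proof.
move=> Pprop Pmono p_pr /and5P[aP bP /allP ap /allP ab /and3P[labP /allP repP trans]] A PA tA tP.
set k := size rep in A PA tA tP *; pose U s := ngraph (orbit_union lab s).
pose va := vperm aP; pose vb := vperm bP.
have labC (x y : 'I_10) : x != y -> lab x y = lab y x.
  by move=> xy; have /and3P[/eqP] := all_pairsP labP xy.
have memU s e x y : x != y -> val e = [set x; y] -> (e \in U s) = nth true s (lab x y).
  by move=> xy eE; rewrite (mem_graph_of _ eE) /orbit_union (labC x y xy) orbb.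
have AU : A = U (nseq k false) := orbit_union_none lab k.
have fix1 c (cP : perm_list c) s :
    (forall x y : 'I_10, x != y -> lab (nth 0%N c x) (nth 0%N c y) = lab x y) ->
    move_graph (vperm cP) (U s) = U s.
  move=> labc; apply: move_graph_fixed => e; have [x [y [xy eE]]] := edge_endpoints e.
  have cxy : vperm cP x != vperm cP y by rewrite (inj_eq perm_inj).
  rewrite (memU s e x y xy eE) (memU s _ _ _ cxy (edge_imageE _ eE)).
  by rewrite !vpermE labc.
have fixU s : move_graph va (U s) = U s /\ move_graph vb (U s) = U s.
  by split; apply: fix1 => x y xy; have /and3P[_ /eqP ? /eqP ?] := all_pairsP labP xy.
have repE l : (l < k)%N -> exists x y : 'I_10, [/\ x != y, nth (0, 0)%N rep l = (x : nat, y : nat)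
    & lab x y = l].
  move=> lk; have := repP l; rewrite mem_iota lk => /(_ isT).
  case: (nth _ _ _) => u v /and4P[uv u10 v10 /eqP uvl].
  by exists (Ordinal u10), (Ordinal v10).
have Ule : {in bits k &, forall s s', (U s \subset U s') = bit_le s s'}.
  move=> s s'; rewrite !mem_bits => /eqP sk /eqP s'k.
  have ss' : size s = size s' by rewrite sk s'k.
  apply/subsetP/(bit_leP ss') => [h l|h e]; rewrite ?sk ?s'k //.
    move=> lk; have [x [y [xy _ xyl]]] := repE l lk; have [e eE] := ex_edge xy.
    by have := h e; rewrite !(memU _ _ _ _ xy eE) xyl.
  have [x [y [xy eE]]] := edge_endpoints e; rewrite !(memU _ _ _ _ xy eE).
  have [lk|lk] := ltnP (lab x y) k; first by apply: h; rewrite sk.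
  by move=> _; rewrite nth_default ?s'k.
have k0 : nseq k false \in bits k by rewrite mem_bits size_nseq.
have ap' x : iter p va x = x.
  apply: val_inj; rewrite /= iter_vpermE; apply/eqP/ap; by rewrite mem_iota /=.
have ab' x : va (vb x) = vb (iter m va x).
  apply: val_inj; rewrite /= !vpermE iter_vpermE; apply/eqP/ab; by rewrite mem_iota /=.
have [aA bA] : move_graph va A = A /\ move_graph vb A = A by rewrite AU.
have := fixed_points_euler Pprop Pmono PA tA tP p_pr ap' ab' aA bA.
set Y := [set H in P | _] => Y0; rewrite -[RHS]Y0; apply/esym.
apply: (@sum_orbit_weights _ P Y k U) => //.
- by move=> G H; apply: monotone_subset.
- by rewrite -AU.
- move=> s sk; have [aU bU] := fixU s; rewrite inE aU bU !eqxx !andbT andbC; congr (_ && _).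
  have sz : size s = k by apply/eqP; rewrite -mem_bits.
  by rewrite properE AU !Ule // -sz bit_le0 bit_le_nseq0 negbK.
move=> H; rewrite inE => /and4P[HP AH /eqP aH /eqP bH].
(* The bits of a fixed graph are read at the representatives; transitivity on each label extends
   them to all edges. *)
pose s := [seq adj H (inord (nth (0, 0)%N rep l).1) (inord (nth (0, 0)%N rep l).2) | l <- iota 0 k].
have sk : size s = k by rewrite size_map size_iota.
exists s; first by rewrite mem_bits sk.
apply/setP => e; have [x [y [xy eE]]] := edge_endpoints e; rewrite (memU _ _ _ _ xy eE).
have [lk|lk] := ltnP (lab x y) k; last first.
  rewrite nth_default ?sk //; apply/(subsetP (proper_sub AH)).
  by rewrite (mem_graph_of _ eE) lk.
rewrite (nth_map 0%N) ?size_iota // nth_iota // add0n.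
have [u [v [uv uvE _]]] := repE _ lk; have [f fE] := ex_edge uv.
have := all_pairsP trans xy; rewrite leqNgt lk uvE /= => /hasP[i _ /hasP[j _ h]].
rewrite !inord_val (mem_adj _ fE) -(mem_iter_fixed i f aH) -(mem_iter_fixed j _ bH).
congr (_ \in H); apply: val_inj.
rewrite eE iter_edge_image iter_edge_image -imset_comp fE imsetU1 imset_set1 /=.
case/orP: h => /andP[/eqP hx /eqP hy]; last rewrite setUC; congr [set _; _];
  by apply: val_inj; rewrite /= !iter_vpermE.
Qed.

(** * Duality and relabelling *)

(** A vanishing alternating sum, phrased with counts in [nat] so that it can be evaluated. *)
Definition balanced k (Q : pred bitseq) : bool :=
  count (fun s => Q s && ~~ odd (count id s)) (bits k) ==
  count (fun s => Q s && odd (count id s)) (bits k).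

Lemma balanced_of_sum k (Q : pred bitseq) :
  \sum_(s <- bits k | Q s) (-1) ^+ count id s = 0 :> int -> balanced k Q.
Proof.
rewrite (bigID (fun s => odd (count id s))) /=.
rewrite (eq_bigr (fun=> -1)) => [|s /andP[_ h]]; last by rewrite -signr_odd h.
rewrite [X in _ + X](eq_bigr (fun=> 1)) => [|s /andP[_ /negbTE h]]; last by rewrite -signr_odd h.
have c (S : pred bitseq) : \sum_(s <- bits k | S s) 1 = (count S (bits k))%:R :> int.
  by rewrite -sum1_count natr_sum.
by rewrite sumrN !c => /eqP; rewrite addrC subr_eq0 eqr_nat.
Qed.

Lemma eq_balanced k (Q Q' : pred bitseq) :
  {in bits k, Q =1 Q'} -> balanced k Q = balanced k Q'.
Proof.
by move=> QQ'; congr (_ == _); apply: eq_in_count => s sk /=; rewrite QQ'.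
Qed.

Section Duality.
Variable n : nat.
Implicit Types (P : {set graph n}) (t : strategy n).

Lemma isomorphicE (G H : graph n) : isomorphic G H -> exists s, H = move_graph s G.
Proof.
move=> /existsP[s /forallP sP]; exists s; apply/setP => f.
have [e ->] : exists e, f = edge_image s e.
  exists (edge_image s^-1 f); apply: val_inj; rewrite /= -imset_comp -[LHS]imset_id.
  by apply: eq_imset => x; rewrite /= permKV.
have [x [y [xy eE]]] := edge_endpoints e; have /forallP/(_ y)/eqP := sP x.
rewrite (mem_adj _ eE) (mem_adj _ (edge_imageE s eE)) => <-.
by rewrite mem_imset //; apply: edge_image_inj.
Qed.

(** The Alexander dual of P as a simplicial complex on the edges. *)
Definition dual P : {set graph n} := [set G | ~: G \notin P].

Lemma dual_property P : graph_property P -> graph_property (dual P).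
Proof.
move=> Pprop G H /isomorphicE[s ->]; rewrite !inE; apply: contra.
suff -> : ~: move_graph s G = move_graph s (~: G) by rewrite move_graph_mem.
apply/setP => f; have [e ->] : exists e, f = edge_image s e.
  exists (edge_image s^-1 f); apply: val_inj; rewrite /= -imset_comp -[LHS]imset_id.
  by apply: eq_imset => x; rewrite /= permKV.
by rewrite !inE !mem_imset ?inE //; apply: edge_image_inj.
Qed.

Lemma dual_monotone P : monotone P -> monotone (dual P).
Proof.
move=> Pmono G e; rewrite !inE; apply: contra; apply: monotone_subset => //.
by rewrite setCS subD1set.
Qed.

Fixpoint dual_strategy t : strategy n :=
  match t with
  | Answer b => Answer (~~ b)
  | Query e t1 t0 => Query e (dual_strategy t0) (dual_strategy t1)
  end.

Lemma questions_dual t : questions (dual_strategy t) = questions t.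
Proof. by elim: t => //= e t1 -> t0 ->; rewrite maxnC. Qed.

Lemma run_dual t G : run (dual_strategy t) G = ~~ run t (~: G).
Proof. by elim: t => //= e t1 IH1 t0 IH0; rewrite inE; case: ifP. Qed.

Fixpoint relabel (s : 'S_n) t : strategy n :=
  match t with
  | Answer b => Answer b
  | Query e t1 t0 => Query (edge_image s e) (relabel s t1) (relabel s t0)
  end.

Lemma questions_relabel s t : questions (relabel s t) = questions t.
Proof. by elim: t => //= e t1 -> t0 ->. Qed.

Lemma run_relabel s t G : run (relabel s t) (move_graph s G) = run t G.
Proof.
elim: t => //= e t1 -> t0 ->; rewrite mem_imset //; exact: edge_image_inj.
Qed.

Lemma card_edge : #|{: edge n}| = 'C(n, 2).
Proof.
rewrite card_sig -[in RHS](card_ord n) -card_draws; apply: eq_card => A.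
by rewrite !inE.
Qed.

Lemma strategy_of_nonevasive P : ~ evasive P ->
  exists2 t : strategy n, (questions t < 'C(n, 2))%N & forall G, run t G = (G \in P).
Proof.
rewrite /evasive /complexity; case: ex_minnP => k /asboolP[t tk tP] kmin kn.
exists t => //; apply: leq_ltn_trans tk _; rewrite ltn_neqAle; apply/andP; split.
  exact/eqP.
apply: kmin; apply/asboolP.
have [|u uk uP] := @strategy_exists n (enum {: edge n}) (fun G => G \in P).
  by move=> G H GH; congr (_ \in P); apply/setP => e; apply: GH; rewrite mem_enum.
by exists u => //; rewrite -card_edge cardE.
Qed.

End Duality.

(** * The ten graphs and the three group actions *)

Definition cdist (n x y : nat) : nat :=
  let d := ((x - y) + (y - x))%N in minn d (n - d).

Definition on_halves (rA rB : nat -> nat -> bool) (x y : nat) : bool :=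
  if (x < 5)%N then (y < 5)%N && rA x y else (5 <= y)%N && rB (x - 5)%N (y - 5)%N.

Definition nonadj (_ _ : nat) : bool := false.
Definition alladj (_ _ : nat) : bool := true.
Definition cyc5 (x y : nat) : bool := cdist 5 x y == 1%N.
Definition compl (r : nat -> nat -> bool) (x y : nat) : bool := ~~ r x y.

(** Positions 0 to 4 are [G1] to [G5], positions 5 to 9 their complements; [targets] adds the empty
    graph at 10 and the complete one at 11. Membership vectors use this numbering. *)
Definition ten_graphs : seq (nat -> nat -> bool) :=
  let gs := [:: on_halves nonadj cyc5; on_halves nonadj alladj; on_halves cyc5 cyc5;
                on_halves cyc5 alladj;
                on_halves alladj alladj] in
  gs ++ map compl gs.

Definition targets : seq (nat -> nat -> bool) := ten_graphs ++ [:: nonadj; alladj].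

(* x |-> u x on the first five vertices and x |-> v x on the last five, possibly swapped *)
Definition half_perms : seq (seq nat) :=
  [seq [seq ((if (x < 5) == w.2 then 0 else 5) +
             ((if x < 5 then w.1.1 else w.1.2) * x) %% 5)%N | x <- iota 0 10]
  | w <- [seq (uv, sw) | uv <- [seq (u, v) | u <- [:: 1; 2], v <- [:: 1; 2]]%N,
                         sw <- [:: true; false]]].

(** Doubling modulo 5 exchanges the five-cycles of distance 1 and distance 2, so [half_perms]
    identifies every union of orbits of the 5 + 5 actions with a target. *)
Definition classify (lab : nat -> nat -> nat) (s : bitseq) : nat :=
  find (fun r => has (iso_check (orbit_union lab s) r) half_perms) targets.

(** Orbits of Z_5 x Z_5: distances 1 and 2 in the first half, the same in the second, and the edges
    in between. In [lab_swap] the halves are merged. *)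
Definition lab_rot (x y : nat) : nat :=
  if (x < 5)%N == (y < 5)%N then ((if x < 5 then 0 else 2) + (cdist 5 x y).-1)%N else 4%N.

Definition lab_swap (x y : nat) : nat :=
  if (x < 5)%N == (y < 5)%N then (cdist 5 x y).-1 else 2%N.

(** Label 5 for {0, 1} exceeds the five orbits, so this edge is always present. Label 0 joins {0, 1}
    to the other eight vertices; 1 to 4 are cyclic distances among those eight. *)
Definition lab_link (x y : nat) : nat :=
  if (x < 2)%N && (y < 2)%N then 5%N else if (x < 2)%N || (y < 2)%N then 0%N
  else cdist 8 x y.

(** Evaluated once, so that the enumeration of membership vectors is mere lookup; [classified]
    certifies every entry afterwards. *)
Definition table_rot : seq nat := Eval vm_compute in map (classify lab_rot) (bits 5).
Definition table_swap : seq nat := Eval vm_compute in map (classify lab_swap) (bits 3).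

Definition table_fun k (table : seq nat) (s : bitseq) : nat :=
  nth 0%N table (index s (bits k)).

Definition membership (P : {set graph 10}) : bitseq := [seq ngraph r \in P | r <- targets].

Definition classified lab table k : bool :=
  all (fun s => let i := table_fun k table s in (i < size targets)%N &&
    has (iso_check (orbit_union lab s) (nth nonadj targets i)) half_perms) (bits k).

Lemma orbit_union_membership (P : {set graph 10}) lab table k :
  graph_property P -> classified lab table k ->
  {in bits k, forall s, (ngraph (orbit_union lab s) \in P) =
    nth false (membership P) (table_fun k table s)}.
Proof.
move=> Pprop /allP h s /h/andP[it /hasP[l _ iso]].
by rewrite (iso_mem Pprop iso) (nth_map nonadj).
Qed.

Lemma empty_ngraph : ngraph nonadj = set0.
Proof.
apply/setP => e; have [x [y [xy eE]]] := edge_endpoints e.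
by rewrite (mem_graph_of _ eE) inE.
Qed.

Lemma complete_ngraph : ngraph alladj = setT.
Proof.
apply/setP => e; have [x [y [xy eE]]] := edge_endpoints e.
by rewrite (mem_graph_of _ eE) inE.
Qed.

Lemma orbit_equation_empty (P : {set graph 10}) (t : strategy 10) p q m la lb lab rep :
  graph_property P -> monotone P -> set0 \in P ->
  (questions t < 'C(10, 2))%N -> (forall G, run t G = (G \in P)) ->
  prime p -> orbit_data p q m la lb lab rep ->
  all_pairs (fun x y => lab x y < size rep)%N ->
  balanced (size rep) (fun s => ngraph (orbit_union lab s) \in P).
Proof.
move=> Pprop Pmono P0 tq tP p_pr od labk; apply: balanced_of_sum.
have A0 : ngraph (fun x y => size rep <= lab x y)%N = set0.
  apply/setP => e; have [x [y [xy eE]]] := edge_endpoints e.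
  have lt1 := all_pairsP labk xy; rewrite eq_sym in xy; have lt2 := all_pairsP labk xy.
  by rewrite (mem_graph_of _ eE) inE (leqNgt (size rep)) lt1 (leqNgt (size rep)) lt2.
apply: (orbit_equation (t := t) Pprop Pmono p_pr od); rewrite A0 //.
by rewrite setC0 cardsT card_edge.
Qed.

(** Three ways to split the eight vertices into 4 + 4, with 0 and 1 on opposite sides: they put
    across the distances 1 and 3, the distance 2, and the distance 4 respectively. *)
Definition into_k55 : seq (seq nat) :=
  [:: [:: 0; 5; 1; 6; 2; 7; 3; 8; 4; 9]; [:: 0; 5; 1; 2; 6; 7; 3; 4; 8; 9];
      [:: 0; 5; 1; 2; 3; 4; 6; 7; 8; 9]]%N.

(** The last five entries run around a five-cycle. There is one for each pair of labels except {1,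
    3}, which lies in K_5,5, and {2, 4}, which is [even_bits]; so any three labels contain a
    five-cycle too. *)
Definition five_cycles : seq (seq nat) :=
  [seq [seq x <- iota 0 10 | x \notin c] ++ c | c <-
    [:: [:: 0; 2; 3; 1; 9]; [:: 0; 2; 4; 1; 9]; [:: 0; 2; 5; 1; 9]; [:: 0; 2; 6; 1; 9];
        [:: 2; 4; 6; 8; 9]; [:: 2; 4; 6; 9; 7]; [:: 2; 6; 5; 4; 3]; [:: 2; 6; 9; 4; 7]]%N].

(** The edge {0, 1} joined to eight independent vertices: a five-cycle would need three vertices to
    cover its edges. In [even_bits] the components are K_2 and two K_4, too small for a five-cycle.
    Both have triangles, so neither lies in K_5,5. *)
Definition star_bits : bitseq := [:: true; false; false; false; false].
Definition even_bits : bitseq := [:: false; false; true; false; true].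

Definition link_value (x y : bool) (s : bitseq) : bool :=
  if has (embed_check (orbit_union lab_link s) (compl (on_halves alladj alladj))) into_k55
  then true else if s == star_bits then x else (s == even_bits) && y.

(* Suppose that C_5 is not in P, and consider the unions of orbits of <(0 1)> x <(2 3 ... 9)>
   that contain the edge {0, 1}.  This edge alone and its five enlargements inside K_{5,5}
   are in P and contribute 1 - 4 + 1 = -2 to the alternating sum.  All others contain C_5,
   except for two, whose contributions 0 or -1 and 0 or 1 cannot make the sum 0. *)
Lemma five_cycle_mem (P : {set graph 10}) (t : strategy 10) :
  graph_property P -> monotone P ->
  (questions t < 'C(10, 2))%N -> (forall G, run t G = (G \in P)) ->
  ngraph (compl (on_halves alladj alladj)) \in P -> ngraph (on_halves nonadj cyc5) \in P.
Proof.
move=> Pprop Pmono; case: t => [b|e t1 t0] tq tP K55.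
  by move: K55; rewrite -!tP.
have [x [y [xy eE]]] := edge_endpoints e.
(* The first question may concern any edge; a relabelling moves it to {0, 1}. *)
have [s sx sy] : exists2 s : 'S_10, s x = inord 0 & s y = inord 1.
  pose u := tperm x (inord 0); exists (u * tperm (u y) (inord 1))%g.
    have n01 : inord 1 != inord 0 :> 'I_10 by rewrite -(inj_eq val_inj) /= !inordK.
    have uy : u y != inord 0.
      by rewrite -(tpermL x (inord 0)) -/u (inj_eq perm_inj) eq_sym.
    by rewrite permM tpermL tpermD.
  by rewrite permM tpermL.
pose e0 := edge_image s e; have e0E : val e0 = [set inord 0; inord 1].
  by rewrite (edge_imageE _ eE) sx sy.
(* After a yes to the first question, the rest of the strategy decides P above [e0] with fewer
   questions than there are other edges, as [orbit_equation] requires. *)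
pose u := relabel s t1.
have uP (H : graph 10) : e0 \in H -> run u H = (H \in P).
  move=> e0H; have [G HG] : exists G, H = move_graph s G.
    exists (move_graph s^-1 H); rewrite /move_graph -imset_comp -[LHS]imset_id.
    apply: eq_imset => f; apply: val_inj; rewrite /= -imset_comp -[LHS]imset_id.
    by apply: eq_imset => z; rewrite /= permKV.
  rewrite HG run_relabel move_graph_mem // -tP /=.
  move: e0H; rewrite HG mem_imset => [-> //|]; exact: edge_image_inj.
have AE : ngraph (fun x y => 5 <= lab_link x y)%N = [set e0].
  apply/setP => f; rewrite in_set1; have [v [w [vw fE]]] := edge_endpoints f.
  rewrite (mem_graph_of _ fE); apply/idP/eqP => [h|fe].
    have : all_pairs (fun x y => (5 <= lab_link x y) || (5 <= lab_link y x) ==>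
        ((x == 0) && (y == 1) || (x == 1) && (y == 0)))%N by vm_compute.
    move=> /all_pairsP/(_ vw)/implyP/(_ h) h'; apply: val_inj; rewrite e0E fE.
    case/orP: h' => /andP[/eqP v0 /eqP w0]; last rewrite setUC; congr [set _; _];
      by apply: val_inj; rewrite /= inordK ?v0 ?w0.
  have : [set v; w] = [set inord 0; inord 1] by rewrite -fE fe.
  by case/set2_eq => -[-> ->]; rewrite !inordK.
(* [a] exchanges 0 and 1, and [b], of order 8, rotates 2, ..., 9 and commutes with [a]. *)
have := @orbit_equation P u 2 8 1 [:: 1; 0; 2; 3; 4; 5; 6; 7; 8; 9]%N
  [:: 0; 1; 3; 4; 5; 6; 7; 8; 9; 2]%N lab_link
  [:: (0, 2); (2, 3); (2, 4); (2, 5); (2, 6)]%N Pprop Pmono isT isT.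
rewrite /= AE => link_sum; apply: contraT => nC5.
have val (l : bitseq) : l \in bits 5 -> (ngraph (orbit_union lab_link l) \in P) =
    link_value (ngraph (orbit_union lab_link star_bits) \in P)
      (ngraph (orbit_union lab_link even_bits) \in P) l.
  have : all (fun l => [|| has (embed_check (orbit_union lab_link l)
      (compl (on_halves alladj alladj))) into_k55, l == star_bits, l == even_bits |
      has (embed_check (on_halves nonadj cyc5) (orbit_union lab_link l)) five_cycles]) (bits 5).
    by vm_compute.
  move=> /allP h /h; rewrite /link_value; case: ifP => [/hasP[w _ ew] _|_].
    exact: embed_mem ew K55.
  case: (l =P star_bits) => [-> //|_]; case: (l =P even_bits) => [-> //|_].
  rewrite !orFb => /hasP[w _ ew].
  by apply: contraNF nC5; apply: embed_mem ew.
have : balanced 5 (link_value (ngraph (orbit_union lab_link star_bits) \in P)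
      (ngraph (orbit_union lab_link even_bits) \in P)).
  rewrite -(eq_balanced val); apply: balanced_of_sum; apply: link_sum => //.
  - by rewrite -AE orbit_union_none val ?mem_bits //; vm_compute.
  - rewrite questions_relabel cardsC1 card_edge ltn_predRL.
    by apply: leq_ltn_trans tq; rewrite ltnS leq_maxl.
  - by move=> H; rewrite sub1set; apply: uP.
by case: (_ \in P); case: (_ \in P); vm_compute.
Qed.

(** * The ten classes *)

Lemma compl_ngraph r : all_pairs (fun x y => r x y == r y x) ->
  ~: ngraph r = ngraph (compl r).
Proof.
move=> rC; apply/setP => e; rewrite in_setC; have [x [y [xy eE]]] := edge_endpoints e.
by rewrite !(mem_graph_of _ eE) /compl (eqP (all_pairsP rC xy)) !orbb.
Qed.

Lemma disjoint_union_half (G H : graph 5) (rA rB : nat -> nat -> bool) :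
  (forall a b : 'I_5, a != b -> adj G a b = rA a b) ->
  (forall a b : 'I_5, a != b -> adj H a b = rB a b) ->
  disjoint_union G H = ngraph (on_halves rA rB) :> graph 10.
Proof.
move=> GA HB; apply/setP => e; have [x [y [xy eE]]] := edge_endpoints e.
have key (u v : 'I_(5 + 5)) : u != v ->
    match split u, split v with
    | inl a, inl b => adj G a b | inr a, inr b => adj H a b | _, _ => false
    end = on_halves rA rB u v.
  rewrite -(inj_eq val_inj) /on_halves /=.
  case: (splitP u) => a ->; case: (splitP v) => b -> uv //.
  - by rewrite GA // -(inj_eq val_inj).
  - by rewrite leqNgt ltn_ord.
  - by rewrite !addKn HB // -(inj_eq val_inj); move: uv; rewrite eqn_add2l.
rewrite !(mem_graph_of _ eE); congr (_ || _); first exact: key.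
by apply: key; rewrite eq_sym.
Qed.

Lemma adj_empty n (a b : 'I_n) : adj (empty_graph n) a b = false.
Proof. by apply/exists_inP => -[e]; rewrite inE. Qed.

Lemma adj_complete n (a b : 'I_n) : a != b -> adj (complete_graph n) a b.
Proof. by move=> /ex_edge[e eE]; rewrite (mem_adj _ eE) inE. Qed.

Lemma adj_cycle5 (a b : 'I_5) : a != b -> adj (cycle_graph 5) a b = cyc5 a b.
Proof.
move=> ab; rewrite adj_graph_of // -!(inj_eq val_inj) /=.
by case: a b {ab} => [[|[|[|[|[|//]]]]] ?] [[|[|[|[|[|//]]]]] ?].
Qed.

Definition class_graphs : seq (graph 10) :=
  [:: G1; G2; G3; G4; G5; ~: G1; ~: G2; ~: G3; ~: G4; ~: G5].

Lemma class_graphsE : class_graphs = [seq ngraph r | r <- ten_graphs].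
Proof.
have e1 : G1 = ngraph (on_halves nonadj cyc5).
  by apply: disjoint_union_half => a b ab; rewrite ?adj_empty ?adj_cycle5.
have e2 : G2 = ngraph (on_halves nonadj alladj).
  by apply: disjoint_union_half => a b ab; rewrite ?adj_empty ?adj_complete.
have e3 : G3 = ngraph (on_halves cyc5 cyc5).
  by apply: disjoint_union_half => a b ab; rewrite ?adj_cycle5.
have e4 : G4 = ngraph (on_halves cyc5 alladj).
  by apply: disjoint_union_half => a b ab; rewrite ?adj_cycle5 ?adj_complete.
have e5 : G5 = ngraph (on_halves alladj alladj).
  by apply: disjoint_union_half => a b ab; rewrite ?adj_complete.
by rewrite /class_graphs e1 e2 e3 e4 e5 !compl_ngraph.
Qed.

Lemma isomorphic_refl n (G : graph n) : isomorphic G G.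
Proof. by apply/existsP; exists 1%g; apply/forallP => x; apply/forallP => y; rewrite !perm1. Qed.

Lemma iso_class_subset n (P : {set graph n}) G :
  graph_property P -> (iso_class G \subset P) = (G \in P).
Proof.
move=> Pprop; apply/subsetP/idP => [h|GP H]; first by apply: h; rewrite inE isomorphic_refl.
by rewrite inE => /Pprop; apply.
Qed.

Lemma ten_set_seq (T : finType) (c1 c2 c3 c4 c5 c6 c7 c8 c9 c10 c : T) :
  (c \in [set c1; c2; c3; c4; c5; c6; c7; c8; c9; c10]) =
  (c \in [:: c1; c2; c3; c4; c5; c6; c7; c8; c9; c10]).
Proof. by rewrite !inE -!orbA. Qed.

Lemma classes_inE (P : {set graph 10}) : graph_property P ->
  classes_in P = [set C in mask (take 10 (membership P)) (map (@iso_class 10) class_graphs)].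
Proof.
move=> Pprop.
have -> : take 10 (membership P) =
    map (fun C : {set graph 10} => C \subset P) (map (@iso_class 10) class_graphs).
  rewrite -map_comp (eq_map (fun G => iso_class_subset G Pprop)).
  by rewrite class_graphsE -map_comp /membership -map_take.
rewrite -filter_mask; apply/setP => C; rewrite inE [RHS]inE mem_filter andbC.
congr (_ && _); apply: ten_set_seq.
Qed.

(* (i, j) stands for an embedding of the i-th target into the j-th. *)
Definition contained_pairs : seq (nat * nat) :=
  [:: (0, 1); (1, 3); (3, 4); (0, 2); (2, 3); (6, 5); (7, 5); (8, 6); (8, 7); (9, 8);
      (0, 8); (2, 7); (1, 6); (3, 5)]%N.

(** Bits 10 and 11 express nontriviality; the other conditions are the inclusions and the equations
    of the two 5 + 5 actions. *)
Definition consistent (B : bitseq) : bool :=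
  [&& nth false B 10, ~~ nth false B 11,
      all (fun ij => nth false B ij.2 ==> nth false B ij.1) contained_pairs,
      balanced 3 (fun s => nth false B (table_fun 3 table_swap s))
    & balanced 5 (fun s => nth false B (table_fun 5 table_rot s))].

Definition type2 : bitseq := [:: true; false; false; false; false; false; false; false; true; true].
Definition type4 : bitseq := [:: true; true; false; false; false; false; true; false; true; true].
Definition type5 : bitseq := [:: true; true; true; true; true; false; false; false; false; false].
Definition type6 : bitseq := [:: true; false; true; false; false; false; false; true; true; true].
Definition type8 : bitseq := [:: true; true; true; false; false; false; true; true; true; true].
Definition only_k55 : bitseq := rcons (nseq 9 false) true.
Definition all_but_2k5 : bitseq := nseq 4 true ++ false :: nseq 5 true.

Section TypeClasses.
Variables (T : finType) (c1 c2 c3 c4 c5 c6 c7 c8 c9 c10 : T).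
Let cs := [:: c1; c2; c3; c4; c5; c6; c7; c8; c9; c10].

Lemma type2_classes : [set c in mask type2 cs] = [set c1; c9; c10].
Proof. by apply/setP => c; rewrite !inE -!orbA. Qed.

Lemma type4_classes : [set c in mask type4 cs] = [set c1; c2; c7; c9; c10].
Proof. by apply/setP => c; rewrite !inE -!orbA. Qed.

Lemma type5_classes : [set c in mask type5 cs] = [set c1; c2; c3; c4; c5].
Proof. by apply/setP => c; rewrite !inE -!orbA. Qed.

Lemma type6_classes : [set c in mask type6 cs] = [set c1; c3; c8; c9; c10].
Proof. by apply/setP => c; rewrite !inE -!orbA. Qed.

Lemma type8_classes : [set c in mask type8 cs] = [set c1; c2; c3; c7; c8; c9; c10].
Proof. by apply/setP => c; rewrite !inE -!orbA. Qed.

End TypeClasses.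

Lemma consistent_cases :
  all (fun B => consistent B ==>
    (take 10 B \in [:: type2; type4; type5; type6; type8; only_k55; all_but_2k5])) (bits 12).
Proof. by vm_compute. Qed.

Lemma membership_cases (P : {set graph 10}) (t : strategy 10) :
  graph_property P -> monotone P -> set0 \in P -> setT \notin P ->
  (questions t < 'C(10, 2))%N -> (forall G, run t G = (G \in P)) ->
  take 10 (membership P) \in
    [:: type2; type4; type5; type6; type8; only_k55; all_but_2k5].
Proof.
move=> Pprop Pmono P0 PT tq tP.
have Bbits : membership P \in bits 12 by rewrite mem_bits.
have nthB i : (i < 12)%N -> nth false (membership P) i = (ngraph (nth nonadj targets i) \in P).
  by move=> i12; rewrite (nth_map nonadj).
apply: (implyP (allP consistent_cases _ Bbits)); apply/and5P; split.
- by rewrite nthB // empty_ngraph.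
- by rewrite nthB // complete_ngraph.
- have chk : all (fun ij => [&& ij.1 < 12, ij.2 < 12 &
      has (embed_check (nth nonadj targets ij.1) (nth nonadj targets ij.2)) half_perms])%N
      contained_pairs by vm_compute.
  apply/allP => ij /(allP chk)/and3P[i12 j12 /hasP[l _ el]].
  by rewrite !nthB //; apply/implyP; apply: embed_mem el.
- have chk : classified lab_swap table_swap 3 by vm_compute.
  rewrite -(eq_balanced (orbit_union_membership Pprop chk)).
  (* [a] rotates the halves in opposite directions; [b] swaps them with a shift by one, so it
     inverts [a] (hence the exponent 4) and b^2 rotates both halves by two. The group of order 50 is
     thereby <a> with cyclic quotient of order 10. *)
  exact: (@orbit_equation_empty P t 5 10 4 [:: 1; 2; 3; 4; 0; 9; 5; 6; 7; 8]%N
    [:: 6; 7; 8; 9; 5; 1; 2; 3; 4; 0]%N lab_swap [:: (0, 1); (0, 2); (0, 5)]%N).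
have chk : classified lab_rot table_rot 5 by vm_compute.
rewrite -(eq_balanced (orbit_union_membership Pprop chk)).
(* Independent rotations of the two halves, hence the exponent 1. *)
exact: (@orbit_equation_empty P t 5 5 1 [:: 1; 2; 3; 4; 0; 5; 6; 7; 8; 9]%N
    [:: 0; 1; 2; 3; 4; 6; 7; 8; 9; 5]%N lab_rot
    [:: (0, 1); (0, 2); (5, 6); (5, 7); (0, 5)]%N).
Qed.

Theorem mainTheorem8 (P : {set graph 10})
    (P_property : graph_property P)
    (P_nontrivial : ~ trivial P)
    (P_monotone : monotone P)
    (P_nonevasive : ~ evasive P) :
  classes_in P = I2 \/ classes_in P = I4 \/ classes_in P = I5 \/
  classes_in P = I6 \/ classes_in P = I8.
Proof.
have [t tq tP] := strategy_of_nonevasive P_nonevasive.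
have P0 : set0 \in P.
  apply/negPn/negP => P0; apply: P_nontrivial; left; apply/setP => G; rewrite inE.
  by apply: contraNF P0 => GP; apply: monotone_subset P_monotone (sub0set G) GP.
have PT : setT \notin P.
  apply/negP => PT; apply: P_nontrivial; right; apply/setP => G; rewrite [RHS]inE.
  exact: monotone_subset P_monotone (subsetT G) PT.
have nthB i : (i < 10)%N ->
    nth false (take 10 (membership P)) i = (ngraph (nth nonadj targets i) \in P).
  by move=> i10; rewrite nth_take // (nth_map nonadj) //; apply: leq_trans i10 _.
have := membership_cases P_property P_monotone P0 PT tq tP.
rewrite (classes_inE P_property) !inE.
case/or4P => [/eqP->|/eqP->|/eqP->|].
- by left; apply: type2_classes.
- by right; left; apply: type4_classes.
- by do 2!right; left; apply: type5_classes.
case/or4P => [/eqP->|/eqP->|/eqP B|/eqP B].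
- by do 3!right; left; apply: type6_classes.
- by do 4!right; apply: type8_classes.
- have := nthB 0%N isT; have := nthB 9 isT; rewrite B /= => K55 /esym/negbT/negP[].
  exact: five_cycle_mem P_property P_monotone tq tP (esym K55).
(* The dual contains K_5,5 because [G5] is not in P, but not [G1] because [~: G1] is in P; this
   contradicts [five_cycle_mem]. *)
have := nthB 4%N isT; have := nthB 5%N isT; rewrite B /= => /esym h1 /esym g5.
have dualE G : run (dual_strategy t) G = (G \in dual P) by rewrite run_dual tP inE.
have := five_cycle_mem (dual_property P_property) (dual_monotone P_monotone) (t := dual_strategy t).
rewrite questions_dual => /(_ tq dualE); rewrite !inE.
rewrite -!compl_ngraph // setCK g5 compl_ngraph // h1. by move/(_ isT).
Qed.
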